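(* Let $q$ be even, let $Q^+(5,q)$ be a hyperbolic (Klein) quadric in $\mathrm{PG}(5,q)$ with associated symplectic polarity $\zeta$, and let $\Pi$ be a $3$-dimensional subspace of $\mathrm{PG}(5,q)$ with $\Pi\cap Q^+(5,q)=Q^-(3,q)$ an elliptic quadric. Let $W(q)$ be the generalized quadrangle whose points are the points of $\Pi$ and whose lines are the lines of $\Pi$ meeting $Q^-(3,q)$ in exactly one point. For an ovoid $O\neq Q^-(3,q)$ of $W(q)$ define \[ H_O:=\Big(\bigcup_{x\in O\setminus Q^-(3,q)}\mathcal{C}_x\Big)\cup\big(Q^-(3,q)\setminus O\big), \] where for $x\in\Pi\setminus Q^-(3,q)$, $\pi_x$ is the plane of $\Pi$ containing all lines of $W(q)$ through $x$ and $\mathcal{C}_x:=\pi_x^\zeta\cap Q^+(5,q)$. Let $O_1,O_2$ be two ovoids of $W(q)$ distinct from $Q^-(3,q)$. Then the following are equivalent: (1) the hyperovals $H_{O_1}$ and $H_{O_2}$ are isomorphic, i.e. there is a collineation of $\mathrm{PG}(5,q)$ stabilizing $Q^+(5,q)$ and mapping $H_{O_1}$ to $H_{O_2}$; (2) there exists a collineation of $\Pi$ stabilizing $Q^-(3,q)$ and mapping $O_1$ to $O_2$.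
   Context: $Q^+(5,q)$ is the set of singular points of a nondegenerate quadratic form $Q$ of plus type on $V=\mathbb{F}_q^6$; $\zeta$ is the symplectic polarity of $\mathrm{PG}(5,q)$ associated with the bilinear form $B(v,w)=Q(v+w)-Q(v)-Q(w)$. An ovoid of $W(q)$ is a set of points of $\Pi$ meeting every line of $W(q)$ in exactly one point. For $x\in\Pi\setminus Q^-(3,q)$, $\pi_x$ meets $Q^-(3,q)$ in an irreducible conic and $\mathcal{C}_x$ is an irreducible conic of the plane $\pi_x^\zeta$. A hyperoval of $Q^+(5,q)$ is a nonempty set of points of $Q^+(5,q)$ meeting every line contained in $Q^+(5,q)$ in $0$ or $2$ points; $H_O$ is such a hyperoval. *)

(* Defs.v *)
From mathcomp Require Import all_boot all_algebra.
From mathcomp Require Import mathcomp_extra boolp classical_sets functions.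

Set Implicit Arguments.
Unset Strict Implicit.
Unset Printing Implicit Defensive.

Import GRing.Theory.
Local Open Scope classical_set_scope.
Local Open Scope ring_scope.

(* Projective subspaces are represented by vector subspaces, so a point is a
   subspace of dimension 1, a line one of dimension 2 and a plane one of
   dimension 3; the projective space PG(n - 1, q) is the full subspace. *)
Section ProjectiveSpace.
Context {F : finFieldType} {n : nat}.
Implicit Types (U : {vspace 'rV[F]_n}).

Definition subspaces (k : nat) U : set {vspace 'rV[F]_n} :=
  [set W | (W <= U)%VS /\ \dim W = k].

Definition points U := subspaces 1 U.
Definition lines U := subspaces 2 U.
Definition planes U := subspaces 3 U.

(* A collineation is given by its action on points, so only the values of f on
   [points U] matter. As the space is finite, a bijection of the points that
   maps every line onto a line also permutes the lines. *)
Definition collineation U (f : {vspace 'rV[F]_n} -> {vspace 'rV[F]_n}) : Prop :=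
  set_bij (points U) (points U) f /\
  forall L, lines U L -> exists2 M, lines U M & f @` points L = points M.

End ProjectiveSpace.

Section Quadrics.
Context {F : finFieldType} {n : nat} (Q : 'rV[F]_n -> F).
Implicit Types (U W : {vspace 'rV[F]_n}).

Definition polar_form (v w : 'rV[F]_n) : F := Q (v + w) - Q v - Q w.

(* The polar form is symmetric, so one-sided linearity gives bilinearity. *)
Definition quadratic_form : Prop :=
  (forall (a : F) v, Q (a *: v) = a ^+ 2 * Q v) /\
  (forall w, scalar (polar_form ^~ w)).

Definition totally_singular W : Prop := {in W, forall v, Q v = 0}.

Definition nondegenerate_on U : Prop :=
  forall v, v \in U -> Q v = 0 -> {in U, forall w, polar_form v w = 0} -> v = 0.

Definition witt_index_on U (m : nat) : Prop :=
  (exists2 W, subspaces m U W & totally_singular W) /\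
  (forall W, (W <= U)%VS -> totally_singular W -> (\dim W <= m)%N).

Definition plus_type_on U : Prop :=
  nondegenerate_on U /\ exists2 m, \dim U = m.*2 & witt_index_on U m.

Definition minus_type_on U : Prop :=
  nondegenerate_on U /\ exists2 m, \dim U = m.+1.*2 & witt_index_on U m.

Definition quadric U : set {vspace 'rV[F]_n} :=
  points U `&` [set p | totally_singular p].

(* The span adds nothing when Q is a quadratic form: see [mem_perp]. *)
Definition perp W : {vspace 'rV[F]_n} :=
  <<enum [pred v : 'rV[F]_n |
          [forall w : 'rV[F]_n, (w \in W) ==> (polar_form v w == 0)%R]]>>%VS.

Lemma mem_perp W v : quadratic_form ->
  v \in perp W <-> {in W, forall w, polar_form v w = 0}.
Proof.
move=> [_ linQ]; rewrite /perp; split=> [|vW]; last first.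
  apply: memv_span; rewrite mem_enum inE.
  by apply/forall_inP=> w /vW ->.
set s := enum _; move=> vs w wW.
have Bs u : u \in s -> polar_form u w = 0.
  by rewrite mem_enum inE => /forall_inP/(_ w wW)/eqP.
have B0 : polar_form 0 w = 0.
  by have := linQ w (-1) 0 0; rewrite scaler0 addr0 mulN1r addNr.
have BD a u z : polar_form (a *: u + z) w = a * polar_form u w + polar_form z w.
  exact: linQ.
rewrite (coord_span (vs : v \in <<in_tuple s>>%VS)).
elim/big_ind: _ => [//|u z Bu Bz|i _].
  by rewrite -[u]scale1r BD Bu Bz mulr0 addr0.
by rewrite -[_ *: _]addr0 BD B0 addr0 Bs ?mulr0// mem_nth.
Qed.

End Quadrics.

Section Hyperovals.
Context {F : finFieldType} (Q : 'rV[F]_6 -> F) (Pi : {vspace 'rV[F]_6}).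
Implicit Types (x L : {vspace 'rV[F]_6}) (O : set {vspace 'rV[F]_6}).

Definition Qplus : set {vspace 'rV[F]_6} := quadric Q fullv.
Definition Qminus : set {vspace 'rV[F]_6} := quadric Q Pi.

Definition W_lines : set {vspace 'rV[F]_6} :=
  [set L | lines Pi L /\ exists! p, points L p /\ Qminus p].

Definition W_ovoid O : Prop :=
  O `<=` points Pi /\ forall L, W_lines L -> exists! p, points L p /\ O p.

(* [xget] is a definite description here: when [Qminus] is an elliptic quadric,
   q is even and x is a point of Pi, there is exactly one such plane. *)
Definition tangent_plane x : {vspace 'rV[F]_6} :=
  xget 0%VS [set p | planes Pi p /\
                     forall L, W_lines L -> (x <= L)%VS -> (L <= p)%VS].

Definition conic x : set {vspace 'rV[F]_6} :=
  points (perp Q (tangent_plane x)) `&` Qplus.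

Definition hyperoval_of O : set {vspace 'rV[F]_6} :=
  (\bigcup_(x in O `\` Qminus) conic x) `|` (Qminus `\` O).

End Hyperovals.

(* Main.v *)
From HB Require Import structures.
Require Import Defs.
From mathcomp Require Import all_boot all_algebra.
From mathcomp Require Import all_fingroup all_solvable all_field.
From mathcomp Require Import mathcomp_extra boolp classical_sets functions.
From mathcomp Require Import zify ring.

(* Let q = #|F|. As Pi is of minus type, V is the orthogonal sum of Pi and an
   anisotropic line L, and for x in Pi and l in L the point <x + l> lies on H_O
   iff Q x = Q l and (<x> is in O iff l <> 0).

   (2) => (1).  By the fundamental theorem of projective geometry a collineation
   of Pi stabilizing Q^-(3,q) comes from a semilinear map, which can be scaled
     so
   that Q is transformed by the field automorphism s alone. It extends to V
   because L carries an s-semilinear isometry: L has a basis on which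
   Q = a^2 + ab + c b^2, and s c + c = t^2 + t for some t since neither c nor s
     c
   has that form.

   (1) => (2).  A collineation of V carries (L, O1) to another pair (L', O')
     that
   yields H_{O2}, and it remains to find an isometry preserving H_{O2} and
   mapping L' to L. Every isometry centralizing the perp of L or of L' preserves
   H_{O2}; counting the images of L' modulo an odd prime divisor of q + 1 gives
   an isometry preserving H_{O2} and mapping L' to L or to a line orthogonal to
   L. In the latter case an explicit involution exchanging the two orthogonal
   lines preserves H_{O2}. *)

Set Implicit Arguments.
Unset Strict Implicit.
Unset Printing Implicit Defensive.

Import GRing.Theory.
Local Open Scope ring_scope.

(** * Finite fields of even order *)

Section CharacteristicTwo.
Context {F : finFieldType} (F_even : ~~ odd #|F|).

Lemma pchar2_of_even : 2 \in [pchar F].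
Proof.
have div2 : (2 %| #|[set: F]|)%N by rewrite cardsT dvdn2.
have [x _ x2] := Cauchy (isT : prime 2) div2.
have x_neq0 : x != 0.
  by apply/eqP=> x0; move: x2; rewrite x0 -[0]/(1%g : F) order1.
rewrite inE /=; apply/eqP/(mulIf x_neq0).
by rewrite mul0r mulr_natl; have := expg_order x; rewrite x2 FinRing.zmodXgE.
Qed.

Lemma two_eq0 : 2%:R = 0 :> F.
Proof. exact: pcharf0 pchar2_of_even. Qed.

Lemma eq_mod2 (k a b : F) : a = b + 2%:R * k -> a = b.
Proof. by rewrite two_eq0 mul0r addr0. Qed.

Lemma oppv_char2 n (v : 'rV[F]_n) : - v = v.
Proof. by apply/rowP=> i; rewrite mxE; apply: (@eq_mod2 (- v 0 i)); ring. Qed.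

Lemma addvv_char2 n (v : 'rV[F]_n) : v + v = 0.
Proof. by rewrite -{2}[v]oppv_char2 subrr. Qed.

Lemma square_root_char2 (c : F) : exists d, d ^+ 2 = c.
Proof.
have inj : injective (fun d : F => d ^+ 2).
  move=> x y /= /eqP; rewrite eqf_sqr oppr_pchar2 ?orbb; first by move/eqP.
  exact: pchar2_of_even.
have /codomP[d ->] : c \in codom (fun d : F => d ^+ 2).
  by rewrite (inj_card_onto inj).
by exists d.
Qed.

(* [x |-> x ^ 2 + x] is additive with kernel {0, 1}, so its image A has index 2;
   were the claim false, A, A + g and A + h would be disjoint. *)
Lemma artin_schreier_sum (g h : F) :
    (forall x : F, x ^+ 2 + x + g != 0) ->
    (forall x : F, x ^+ 2 + x + h != 0) ->
  exists t : F, t ^+ 2 + t + g = h.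
Proof.
move=> noG noH; pose P (x : F) := x ^+ 2 + x.
have PD x y : P (x + y) = P x + P y.
  by apply: (@eq_mod2 (x * y)); rewrite /P; ring.
pose A := [set P x | x : F].
have leA : (#|F| <= #|A| * 2)%N.
  rewrite -[#|F|]sum1_card (partition_big P (mem A)) /=; last first.
    by move=> x _; apply: imset_f.
  rewrite -[leqRHS]sum_nat_const; apply: leq_sum => _ /imsetP[x _ ->].
  rewrite sum1_card; have : (#|[set x; (x + 1)%R]| <= 2)%N
    by rewrite cards2 ltnS leq_b1.
  apply: leq_trans.
  apply: subset_leq_card; apply/fintype.subsetP => y;
    rewrite inE /= => /eqP Pyx.
  have /eqP : (y - x) * (y - x - 1) = 0.
    have y2 : y ^+ 2 = x ^+ 2 + x - y by rewrite -[_ + x]Pyx addrK.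
    by apply: (@eq_mod2 (x ^+ 2 + x - y - x * y)); ring: y2.
  rewrite mulf_eq0 !inE subr_eq0 => /orP[->//|].
  by rewrite subr_eq0 subr_eq addrC => ->; rewrite orbT.
pose Ag := [set a + g | a in A]; pose Ah := [set a + h | a in A].
have card_sh c : #|[set a + c | a in A]| = #|A|.
  by apply: card_imset => a b /addIr.
apply: contrapT => no.
have d1 : [disjoint A & Ag].
  apply/pred0P => z /=; apply/negP => /andP[/imsetP[x _ ->]].
  case/imsetP=> _ /imsetP[y _ ->] xy.
  move: (noG (x + y)); rewrite -[_ + (x + y)]/(P (x + y)) PD xy.
  by apply/negP; rewrite negbK; apply/eqP/(@eq_mod2 (P y + g)); ring.
have d2 : [disjoint A :|: Ag & Ah].
  apply/pred0P => z /=; apply/negP => /andP[].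
  rewrite inE => /orP[/imsetP[x _ ->]|/imsetP[_ /imsetP[x _ ->] ->]];
    case/imsetP=> _ /imsetP[y _ ->] xy.
    move: (noH (x + y)); rewrite -[_ + (x + y)]/(P (x + y)) PD xy.
    by apply/negP; rewrite negbK; apply/eqP/(@eq_mod2 (P y + h)); ring.
  apply: no; exists (x + y); rewrite -[_ + (x + y)]/(P (x + y)) PD.
  apply: (@eq_mod2 (P y)); rewrite addrAC xy; ring.
have := max_card (mem (A :|: Ag :|: Ah)).
move: d1 d2; rewrite -!finset.setI_eq0 !cardsU => /eqP-> /eqP->.
rewrite !cards0 !subn0 !card_sh => le3.
have A_gt0 : (0 < #|A|)%N by apply/card_gt0P; exists (P 0); apply: imset_f.
by move: (leq_trans le3 leA); rewrite -addnA muln2 -addnn leq_add2l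
  -[leqRHS]addn0 leq_add2l leqNgt A_gt0.
Qed.
End CharacteristicTwo.

(** * Projective points and lines *)

Section Lines.
Context {F : finFieldType} {n : nat}.
Implicit Types (U L p : {vspace 'rV[F]_n}) (u v w x y : 'rV[F]_n).

Lemma vline_scale (k : F) v : k != 0 -> (<[k *: v]> = <[v]>)%VS.
Proof.
move=> k0; apply/vspaceP=> x; apply/vlineP/vlineP=> -[c ->].
  by exists (c * k); rewrite scalerA.
by exists (c / k); rewrite scalerA divfK.
Qed.

Lemma dim1_vline p : \dim p = 1 -> exists2 v, v != 0 & p = <[v]>%VS.
Proof.
move=> dimp; have p0 : vpick p != 0 by rewrite vpick0 -dimv_eq0 dimp.
exists (vpick p) => //; apply/esym/eqP.
by rewrite eqEdim -memvE memv_pick dimp dim_vline p0.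
Qed.

Lemma vline_sym x y : x != 0 -> x \in <[y]>%VS -> y \in <[x]>%VS.
Proof.
move=> x0 /vlineP[k xE]; apply/vlineP; exists k^-1.
have k0 : k != 0 by apply: contra_neq x0 => k0; rewrite xE k0 scale0r.
by rewrite xE scalerA mulVf ?scale1r.
Qed.

Lemma vline_eq x y : x != 0 -> x \in <[y]>%VS -> (<[x]> = <[y]>)%VS.
Proof.
move=> x0 xy; apply/eqP; rewrite eqEsubv -!memvE xy /=; exact: vline_sym.
Qed.

Lemma cap_vline u w : w \notin <[u]>%VS -> (<[u]> :&: <[w]> = 0)%VS.
Proof.
move=> wNu; apply/eqP; rewrite -subv0; apply/subvP=> x; rewrite memv_cap memv0.
case/andP=> xu xw; apply: contraNT wNu => x0.
by rewrite -(vline_eq x0 xu); apply: vline_sym.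
Qed.

Lemma dim_add_vline u w : u != 0 -> w \notin <[u]>%VS -> \dim (<[u]> + <[w]>) =
  2.
Proof.
move=> u0 wNu; rewrite dimv_disjoint_sum ?cap_vline// !dim_vline u0.
by rewrite (_ : w != 0)//; apply: contraNneq wNu => ->; rewrite mem0v.
Qed.

Lemma line2_span L u w : \dim L = 2 -> u \in L -> w \in L ->
    u != 0 -> w \notin <[u]>%VS ->
  {in L, forall v, exists a b, v = a *: u + b *: w}.
Proof.
move=> dimL uL wL u0 wNu v vL.
have LE : (<[u]> + <[w]>)%VS = L.
  by apply/eqP; rewrite eqEdim subv_add -!memvE uL wL dimL dim_add_vline.
move: vL; rewrite -LE.
by case/memv_addP=> _ /vlineP[a ->] [_ /vlineP[b ->] ->]; exists a, b.
Qed.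

Lemma memv_addl_line u w : u \in (<[u]> + <[w]>)%VS.
Proof. by apply: (subvP (addvSl _ _)); apply: memv_line. Qed.

Lemma memv_addr_line u w : w \in (<[u]> + <[w]>)%VS.
Proof. by apply: (subvP (addvSr _ _)); apply: memv_line. Qed.

Lemma points_vline U v : v \in U -> v != 0 -> points U <[v]>%VS.
Proof. by move=> vU v0; split; rewrite -?memvE ?dim_vline ?v0. Qed.

End Lines.

(** * The polar form *)

Section PolarForm.
Context {F : finFieldType} {n : nat} (Q : 'rV[F]_n -> F).
Context (quadQ : quadratic_form Q).
Implicit Types (U W L : {vspace 'rV[F]_n}) (v w : 'rV[F]_n).
Local Notation B := (polar_form Q).

Lemma polarC v w : B v w = B w v.
Proof. by rewrite /polar_form [w + v]addrC addrAC. Qed.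

Lemma polarPl (a : F) u v w : B (a *: u + v) w = a * B u w + B v w.
Proof. by have [_ /(_ w a u v)] := quadQ. Qed.

Lemma polar0l w : B 0 w = 0.
Proof. by have := polarPl (-1) 0 0 w; rewrite scaler0 addr0 mulN1r addNr. Qed.

Lemma polarZl a v w : B (a *: v) w = a * B v w.
Proof. by rewrite -[a *: v]addr0 polarPl polar0l addr0. Qed.

Lemma polarDl u v w : B (u + v) w = B u w + B v w.
Proof. by rewrite -[u]scale1r polarPl mul1r scale1r. Qed.

Lemma polar0r v : B v 0 = 0.
Proof. by rewrite polarC polar0l. Qed.

Lemma polarZr a v w : B v (a *: w) = a * B v w.
Proof. by rewrite polarC polarZl polarC. Qed.

Lemma polarDr u v w : B u (v + w) = B u v + B u w.
Proof. by rewrite polarC polarDl !(polarC u). Qed.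

Lemma polarNl v w : B (- v) w = - B v w.
Proof. by rewrite -scaleN1r polarZl mulN1r. Qed.

Lemma polarNr v w : B v (- w) = - B v w.
Proof. by rewrite polarC polarNl polarC. Qed.

Definition polarE := (polarDl, polarDr, polarZl, polarZr, polarNl, polarNr).

Lemma quadZ a v : Q (a *: v) = a ^+ 2 * Q v.
Proof. by have [->] := quadQ. Qed.

Lemma quad0 : Q 0 = 0.
Proof. by rewrite -(scale0r 0) quadZ expr0n mul0r. Qed.

Lemma quadD v w : Q (v + w) = Q v + Q w + B v w.
Proof. by rewrite /polar_form; ring. Qed.

Lemma quadN v : Q (- v) = Q v.
Proof. by rewrite -scaleN1r quadZ sqrrN expr1n mul1r. Qed.

Definition quadE := (quadD, quadZ, quadN).

Lemma perpP W v : reflect {in W, forall w, B v w = 0} (v \in perp Q W).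
Proof. by apply: (iffP idP) => /mem_perp; apply. Qed.

Lemma perp_line v w : (v \in perp Q <[w]>) = (B v w == 0).
Proof.
apply/perpP/eqP => [-> //|Bvw _ /vlineP[k ->]]; first exact: memv_line.
by rewrite polarZr Bvw mulr0.
Qed.

Lemma dim_cap_perp U W : (\dim W <= \dim (W :&: perp Q U) + \dim U)%N.
Proof.
pose T v := \row_(i < \dim U) B v (vbasis U)`_i.
have linT : linear T.
  by move=> a v w; apply/rowP=> i; rewrite !mxE polarPl.
pose f : {linear 'rV[F]_n -> 'rV[F]_(\dim U)} :=
  HB.pack T (GRing.isLinear.Build _ _ _ _ T linT).
have kerT : lker (linfun f) = perp Q U.
  apply/vspaceP=> v; rewrite memv_ker lfunE /= /T.
  apply/eqP/perpP=> [/rowP Tv w wU|vU].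
    rewrite (coord_vbasis wU); elim/big_ind: _ => [|x y Bx By|i _].
    - exact: polar0r.
    - by rewrite polarDr Bx By addr0.
    - by have := Tv i; rewrite !mxE polarZr => ->; rewrite mulr0.
  by apply/rowP=> i; rewrite !mxE vU// vbasis_mem// mem_nth// size_tuple.
rewrite -(limg_ker_dim (linfun f) W) kerT leq_add2l.
by apply: leq_trans (dimvS (subvf _)) _; rewrite dimvf /dim /= mul1n.
Qed.

Definition polar_nondegenerate U : Prop :=
  forall v, v \in U -> {in U, forall w, B v w = 0} -> v = 0.

Lemma cap_perp_nondeg U : polar_nondegenerate U -> (U :&: perp Q U = 0)%VS.
Proof.
move=> ndU; apply/eqP; rewrite -subv0; apply/subvP=> v.
by rewrite memv_cap memv0 => /andP[vU /perpP/ndU->].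
Qed.

Lemma add_perp_nondeg U : polar_nondegenerate U -> (U + perp Q U = fullv)%VS.
Proof.
move=> ndU; apply/eqP; rewrite eqEdim subvf dimv_disjoint_sum
  ?cap_perp_nondeg//.
by rewrite addnC; have := dim_cap_perp U fullv; rewrite capfv.
Qed.

Lemma perp_split U v : polar_nondegenerate U ->
  exists2 x, x \in U & exists2 y, y \in perp Q U & v = x + y.
Proof. by move=> /add_perp_nondeg eqU; apply/memv_addP; rewrite eqU memvf. Qed.

Lemma perp_perp U : polar_nondegenerate U -> polar_nondegenerate (perp Q U) ->
  perp Q (perp Q U) = U.
Proof.
move=> ndU ndU'; apply/vspaceP=> v; apply/perpP/idP=> [vU|vU w /perpP wU].
  have [x xU [y yU' vE]] := perp_split v ndU.
  suff -> : v = x by [].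
  rewrite vE (_ : y = 0) ?addr0//; apply: ndU' => // w wU'.
  have := vU w wU'; rewrite vE polarDl (polarC x).
  by move/perpP: (wU') => ->//; rewrite add0r.
by rewrite polarC wU.
Qed.

Lemma dim_perp U : polar_nondegenerate U -> \dim (perp Q U) = (n - \dim U)%N.
Proof.
move=> ndU; have := dimv_disjoint_sum (cap_perp_nondeg ndU).
by rewrite add_perp_nondeg// dimvf /dim /= mul1n => /(congr1 (subn^~ (\dim U)))
  /= ->; rewrite addKn.
Qed.

Definition anisotropic U : Prop := {in U, forall v, Q v = 0 -> v = 0}.

Lemma totally_singular_line v : Q v = 0 -> totally_singular Q <[v]>%VS.
Proof. by move=> Qv _ /vlineP[k ->]; rewrite quadZ Qv mulr0. Qed.

Lemma quadricE U v : v \in U -> v != 0 -> quadric Q U <[v]>%VS <-> Q v = 0.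
Proof.
move=> vU v0; split=> [[_ sing]|Qv]; first by apply: sing; apply: memv_line.
by split; [exact: points_vline|exact: totally_singular_line].
Qed.

Definition hyperbolic_pair U p r : Prop :=
  [/\ p \in U, r \in U, Q p = 0, Q r = 0 & B p r = 1].

Lemma hyperbolic_pair_exists U p w :
    p \in U -> w \in U -> Q p = 0 -> B p w != 0 ->
  exists r, hyperbolic_pair U p r.
Proof.
move=> pU wU Qp Bpw; pose w1 := (B p w)^-1 *: w.
have Bpw1 : B p w1 = 1 by rewrite polarZr mulVf.
have w1U : w1 \in U by apply: memvZ.
clearbody w1.
exists (w1 - Q w1 *: p); split=> //.
- by rewrite memvB ?memvZ.
- by rewrite !quadE !polarE Qp (polarC w1) Bpw1; ring.
- rewrite polarDr polarNr polarZr Bpw1.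
  have -> : B p p = 0 by rewrite /polar_form -mulr2n -scaler_nat quadZ Qp mulr0
    !subr0.
  by rewrite mulr0 subr0.
Qed.

Section Even.
Context (F_even : ~~ odd #|F|).

Lemma polarvv v : B v v = 0.
Proof. by rewrite /polar_form addvv_char2// quad0 sub0r -opprD (addrr_pchar2
  (pchar2_of_even F_even)) oppr0. Qed.

Definition normalized_basis L u w : Prop :=
  [/\ u \in L, w \in L, Q u = 1, B u w = 1 &
      {in L, forall v, v = B v w *: u + B v u *: w}].

Lemma normalized_basis_exists L : \dim L = 2%N -> anisotropic L ->
  exists u w, normalized_basis L u w.
Proof.
move=> dimL anL; pose v0 := vpick L.
have v0L : v0 \in L by apply: memv_pick.
have v00 : v0 != 0 by rewrite vpick0 -dimv_eq0 dimL.
have Qv0 : Q v0 != 0 by apply: contra_neq v00 => /anL->.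
have [d d2] := square_root_char2 F_even (Q v0)^-1.
pose u := d *: v0; have uL : u \in L by apply: memvZ.
have Qu : Q u = 1 by rewrite quadZ d2 mulVf.
clearbody u; have u0 : u != 0 by apply/eqP=> u0; move: Qu;
  rewrite u0 quad0 => /eqP; rewrite eq_sym oner_eq0.
have /subvPn[w wL wNu] : ~~ (L <= <[u]>)%VS.
  by apply/negP=> /dimvS; rewrite dimL dim_vline u0.
have Buw : B u w != 0.
  apply: contraNneq wNu => Buw0; have [t t2] := square_root_char2 F_even (Q w).
  suff /eqP : w - t *: u = 0 by rewrite subr_eq0 => /eqP->;
    rewrite memvZ ?memv_line.
  apply: anL; first by rewrite memvB ?memvZ.
  rewrite !quadE polarNr polarZr polarC Buw0 Qu t2.
  by apply: (eq_mod2 F_even (k := Q w)); ring.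
pose w1 := (B u w)^-1 *: w; have Buw1 : B u w1 = 1 by rewrite polarZr mulVf.
have w1L : w1 \in L by apply: memvZ.
clearbody w1; have w1Nu : w1 \notin <[u]>%VS.
  apply/negP=> /vlineP[k w1E]; have := Buw1.
  by rewrite w1E polarZr polarvv mulr0 => /eqP; rewrite eq_sym oner_eq0.
exists u, w1; split=> // v /(line2_span dimL uL w1L u0 w1Nu)[a [b ->]].
by rewrite !polarE !polarvv (polarC w1) Buw1 !mulr0 !mulr1 addr0 add0r.
Qed.

Lemma anisotropic_nondeg L : \dim L = 2%N -> anisotropic L ->
  polar_nondegenerate L.
Proof.
move=> dimL anL v vL Bv.
have [u [w [uL wL _ _ /(_ v vL)->]]] := normalized_basis_exists dimL anL.
by rewrite !Bv// !scale0r addr0.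
Qed.

Lemma normalized_basis_no_root L u w : anisotropic L -> normalized_basis L u w
  ->
  forall x : F, x ^+ 2 + x + Q w != 0.
Proof.
move=> anL [uL wL Qu Buw _] x.
have <- : Q (x *: u + w) = x ^+ 2 + x + Q w.
  by rewrite !quadE polarZl Qu Buw; ring.
apply/eqP=> /anL xw; have : B u (x *: u + w) = 0.
  by rewrite xw ?polar0r// memvD ?memvZ.
by rewrite !polarE polarvv mulr0 add0r Buw => /eqP; rewrite oner_eq0.
Qed.

Lemma normalized_basis_shift L u w t : normalized_basis L u w ->
  normalized_basis L u (w + t *: u) /\ Q (w + t *: u) = t ^+ 2 + t + Q w.
Proof.
move=> [uL wL Qu Buw LE]; split; last first.
  by rewrite !quadE polarZr polarC Qu Buw; ring.
split=> //; first by rewrite memvD ?memvZ.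
  by rewrite polarDr polarZr polarvv mulr0 addr0.
move=> v vL; rewrite {1}(LE v vL) polarDr polarZr.
apply/rowP=> i; rewrite !mxE.
by apply: (eq_mod2 F_even (k := - t * B v u * u 0 i)); ring.
Qed.

End Even.
End PolarForm.

(** * Semilinear maps *)

Section Semilinear.
Context {F : finFieldType} {n : nat}.
Implicit Types (s : {rmorphism F -> F}) (f : 'rV[F]_n -> 'rV[F]_n).
Implicit Types (U : {vspace 'rV[F]_n}) (u v : 'rV[F]_n).

Definition is_semilinear s f : Prop :=
  forall a x y, f (a *: x + y) = s a *: f x + f y.

Lemma fmorph_finK s : exists s' : {rmorphism F -> F}, cancel s s' /\ cancel s'
  s.
Proof.
have [s' sK s'K] := injF_bij (fmorph_inj s).
have s'A : zmod_morphism s' by apply: can2_zmod_morphism sK s'K.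
have s'M : monoid_morphism s' by apply: can2_monoid_morphism sK s'K.
pose t : {rmorphism F -> F} :=
  HB.pack s' (GRing.isZmodMorphism.Build _ _ s' s'A)
             (GRing.isMonoidMorphism.Build _ _ s' s'M).
by exists t.
Qed.

Section Theory.
Context (s : {rmorphism F -> F}) (f : 'rV[F]_n -> 'rV[F]_n).
Context (lin_f : is_semilinear s f).

Lemma semilinear0 : f 0 = 0.
Proof.
by have := lin_f (-1) 0 0; rewrite scaler0 addr0 rmorphN1 scaleN1r addNr.
Qed.

Lemma semilinearZ a x : f (a *: x) = s a *: f x.
Proof. by rewrite -[a *: x]addr0 lin_f semilinear0 addr0. Qed.

Lemma semilinearD x y : f (x + y) = f x + f y.
Proof. by rewrite -[x]scale1r lin_f rmorph1 !scale1r. Qed.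

Lemma semilinearN x : f (- x) = - f x.
Proof. by rewrite -scaleN1r semilinearZ rmorphN1 scaleN1r. Qed.

Definition semilinear_img (U : {vspace 'rV[F]_n}) : {vspace 'rV[F]_n} :=
  <<[seq f v | v <- enum U]>>%VS.

Lemma semilinear_imgP U v :
  reflect (exists2 u, u \in U & v = f u) (v \in semilinear_img U).
Proof.
apply: (iffP idP) => [|[u uU ->]]; last first.
  by apply: memv_span; rewrite map_f ?mem_enum.
have [s' [_ s'K]] := fmorph_finK s.
rewrite /semilinear_img; set X := map _ _ => vX.
rewrite (coord_span (vX : v \in <<in_tuple X>>%VS)).
elim/big_ind: _ => [|x y [a aU ->] [b bU ->]|i _].
- by exists 0; rewrite ?mem0v ?semilinear0.
- by exists (a + b); rewrite ?memvD ?semilinearD.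
have /mapP[u] : (in_tuple X)`_i \in X by rewrite mem_nth.
rewrite mem_enum => uU ->; exists (s' (coord (in_tuple X) i v) *: u).
  by rewrite memvZ.
by rewrite semilinearZ s'K.
Qed.

Lemma mem_semilinear_img f' U v : cancel f f' -> cancel f' f ->
  (v \in semilinear_img U) = (f' v \in U).
Proof.
move=> fK f'K; apply/semilinear_imgP/idP => [[u uU ->]|vU]; first by rewrite fK.
by exists (f' v); rewrite ?f'K.
Qed.

Lemma semilinear_img_line u : semilinear_img <[u]> = <[f u]>%VS.
Proof.
have [s' [_ s'K]] := fmorph_finK s.
apply/vspaceP=> v; apply/semilinear_imgP/vlineP => [[_ /vlineP[k ->] ->]|[k
  ->]].
  by exists (s k); rewrite semilinearZ.
by exists (s' k *: u); rewrite ?memvZ ?memv_line// semilinearZ s'K.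
Qed.

Lemma dim_semilinear_img U : injective f -> \dim (semilinear_img U) = \dim U.
Proof.
move=> f_inj; apply/eqP.
rewrite -(eqn_exp2l _ _ (finNzRing_gt1 F)) -!card_vspace.
rewrite -(card_imset (mem U) f_inj); apply/eqP/eq_card => v.
by apply/semilinear_imgP/imsetP.
Qed.

End Theory.

End Semilinear.

(** * Pairs representing a hyperoval *)

Section Represents.
Context {F : finFieldType} {n : nat} (Q : 'rV[F]_n -> F).
Context (quadQ : quadratic_form Q).
Implicit Types (U L M : {vspace 'rV[F]_n}) (u v w x y : 'rV[F]_n).
Implicit Types (O H : pred 'rV[F]_n) (s : {rmorphism F -> F}).
Local Notation B := (polar_form Q).

Definition semi_isometry s (f : 'rV[F]_n -> 'rV[F]_n) : Prop :=
  is_semilinear s f /\ forall v, Q (f v) = s (Q v).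

Lemma semi_isometry_polar s f v w : semi_isometry s f ->
  B (f v) (f w) = s (B v w).
Proof.
by case=> lin_f Qf; rewrite /polar_form -(semilinearD lin_f) !Qf !rmorphB.
Qed.

(* For l != 0 the point <x + l> can only lie on the conic of <x>, and for l = 0
   only on Q^-(3,q) \ O. *)
Definition represents L O H : Prop :=
  forall x l, x \in perp Q L -> l \in L -> x + l != 0 ->
    H (x + l) = (Q x == Q l) && (O x == (l != 0)).

Definition partial_ovoid U O : Prop :=
  {in U &, forall x y, O x -> O y -> B x y = 0 -> y \in <[x]>%VS}.

Lemma perp_semi_isometry s f f' L v :
    semi_isometry s f -> cancel f f' -> cancel f' f ->
  (v \in perp Q (semilinear_img f L)) = (f' v \in perp Q L).
Proof.
move=> isof fK f'K; have [lin_f Qf] := isof.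
apply/(perpP quadQ)/(perpP quadQ) => [Bv w wL|Bv w].
  apply/eqP; rewrite -(fmorph_eq0 s) -(semi_isometry_polar _ _ isof) f'K.
  by rewrite Bv//; apply/(semilinear_imgP lin_f); exists w.
case/(semilinear_imgP lin_f) => u uL ->.
by rewrite -[v]f'K (semi_isometry_polar _ _ isof) Bv ?rmorph0.
Qed.

Lemma represents_img s f f' L O H :
    semi_isometry s f -> cancel f f' -> cancel f' f -> represents L O H ->
  represents (semilinear_img f L) (O \o f') (H \o f').
Proof.
move=> isof fK f'K repH x l; have [lin_f Qf] := isof.
rewrite (perp_semi_isometry _ _ isof fK f'K).
rewrite (mem_semilinear_img lin_f _ _ fK f'K) => xL lL.
have E0 z : (f' z == 0) = (z == 0).
  by rewrite -{1}[0]fK (semilinear0 lin_f) (can_eq f'K).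
rewrite -E0 /=.
have -> : f' (x + l) = f' x + f' l.
  by apply: (can_inj fK); rewrite (semilinearD lin_f) !f'K.
move=> nz; rewrite (repH _ _ xL lL nz).
by rewrite E0 -(inj_eq (fmorph_inj s)) -!Qf !f'K.
Qed.

Lemma partial_ovoid_img s f f' L O :
    semi_isometry s f -> cancel f f' -> cancel f' f ->
  partial_ovoid (perp Q L) O ->
  partial_ovoid (perp Q (semilinear_img f L)) (O \o f').
Proof.
move=> isof fK f'K ovO x y; have [lin_f Qf] := isof.
rewrite !(perp_semi_isometry _ _ isof fK f'K) => xL yL Ox Oy Bxy.
have /vlineP[k kE] : f' y \in <[f' x]>%VS.
  apply: ovO => //; apply/eqP.
  by rewrite -(fmorph_eq0 s) -(semi_isometry_polar _ _ isof) !f'K Bxy.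
by apply/vlineP; exists (s k); rewrite -[y]f'K kE (semilinearZ lin_f) f'K.
Qed.

Lemma anisotropic_img s f L :
  semi_isometry s f -> anisotropic Q L -> anisotropic Q (semilinear_img f L).
Proof.
case=> lin_f Qf anL _ /(semilinear_imgP lin_f)[u uL ->] /eqP.
by rewrite Qf fmorph_eq0 => /eqP/anL->//; rewrite (semilinear0 lin_f).
Qed.

Section Even.
Context (F_even : ~~ odd #|F|).

Definition elliptic_line L : Prop := \dim L = 2 /\ anisotropic Q L.

Lemma elliptic_nondeg L : elliptic_line L -> polar_nondegenerate Q L.
Proof. by case=> dimL anL; apply: anisotropic_nondeg. Qed.

Lemma perp_add_eq0 L x l : elliptic_line L -> x \in perp Q L -> l \in L ->
  (x + l == 0) = (x == 0) && (l == 0).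
Proof.
move=> ellL xL lL; apply/idP/andP=> [|[/eqP-> /eqP->]]; last by rewrite addr0.
rewrite addr_eq0 => /eqP xE.
have x0 : x = 0.
  by apply: (elliptic_nondeg ellL) (perpP quadQ _ _ xL); rewrite xE memvN.
by move: xE; rewrite x0 => /esym/eqP; rewrite oppr_eq0 => ->.
Qed.

Lemma represents_off L O H x l : elliptic_line L -> represents L O H ->
  x \in perp Q L -> l \in L -> l != 0 -> H (x + l) = (Q x == Q l) && O x.
Proof.
move=> ellL repH xL lL l_neq0; rewrite repH ?l_neq0 ?eqb_id//.
by rewrite (perp_add_eq0 ellL)// negb_and l_neq0 orbT.
Qed.

Lemma represents_on L O H x : represents L O H ->
  x \in perp Q L -> x != 0 -> H x = (Q x == 0) && ~~ O x.
Proof.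
move=> repH xL x_neq0; rewrite -{1}[x]addr0 repH ?mem0v ?addr0//.
by rewrite (quad0 quadQ) eqxx eqbF_neg.
Qed.

Lemma represents_norm L O H x l m : elliptic_line L -> represents L O H ->
    x \in perp Q L -> l \in L -> m \in L -> Q l = Q m ->
  H (x + l) = H (x + m).
Proof.
move=> ellL repH xL lL mL Qlm; have [dimL anL] := ellL.
have l0E : (l == 0) = (m == 0).
  by apply/eqP/eqP=> z0; apply: anL => //;
    [rewrite -Qlm|rewrite Qlm]; rewrite z0 (quad0 quadQ).
have [l0|l_neq0] := eqVneq l 0.
  by move: (l0E); rewrite l0 eqxx => /esym/eqP->.
by rewrite !(represents_off ellL repH) -?l0E// Qlm.
Qed.

Definition swap t r v := v + B v r *: t - B v t *: r.

(* [swap t r] exchanges L = <u, w> and M = <u', w'> when t = u - u' and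
   r = w - w'. *)
Lemma swap_semi_isometry t r : Q t = 0 -> Q r = 0 -> B t r = 0 ->
  semi_isometry idfun (swap t r).
Proof.
move=> Qt Qr Btr; split=> [a x y|v].
  by apply/rowP=> i; rewrite !mxE !(polarE quadQ) /=; ring.
rewrite /swap !(quadE quadQ) !(polarE quadQ) Qt Qr Btr /=; ring.
Qed.

Lemma swapK t r : Q t = 0 -> Q r = 0 -> B t r = 0 -> involutive (swap t r).
Proof.
move=> Qt Qr Btr v; rewrite /swap !(polarE quadQ) !(polarvv quadQ F_even).
rewrite (polarC _ r t) Btr; apply/rowP=> i; rewrite !mxE.
by apply: (eq_mod2 F_even (k := B v r * t 0 i - B v t * r 0 i)); ring.
Qed.

(* Write v = y + x + l with x in M and l in L; [repM] and [repL] then decide H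
   on the same vectors in two ways. *)
Lemma swap_represents L M O O' H t r :
    elliptic_line L -> elliptic_line M -> (M <= perp Q L)%VS ->
    represents L O H -> represents M O' H ->
    partial_ovoid (perp Q L) O -> partial_ovoid (perp Q M) O' ->
    semi_isometry idfun (swap t r) -> involutive (swap t r) ->
    {in L, forall l, swap t r l \in M} -> {in M, forall x, swap t r x \in L} ->
    {in perp Q L, forall y, y \in perp Q M -> swap t r y = y} ->
  forall v, H (swap t r v) = H v.
Proof.
set T := swap t r; move=> ellL ellM perpML repL repM ovO ovO' isoT TK TLM TML
  Tfix.
have [linT QT] := isoT.
have TD x y : T (x + y) = T x + T y by apply: semilinearD linT x y.
have perpLM : (L <= perp Q M)%VS.
  apply/subvP=> l lL; apply/(perpP quadQ) => m mM.
  by rewrite polarC; apply: (perpP quadQ _ _ (subvP perpML m mM)).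
have Lp l : l \in L -> l \in perp Q M by apply: subvP.
have Mp l : l \in M -> l \in perp Q L by apply: subvP.
suff main y x l : y \in perp Q L -> y \in perp Q M -> x \in M -> l \in L ->
    H (y + x + l) -> H (y + T x + T l).
  move=> v.
  have [l lL [z zL vE]] := perp_split quadQ v (elliptic_nondeg ellL).
  have [x xM [y yM zE]] := perp_split quadQ z (elliptic_nondeg ellM).
  have yL : y \in perp Q L.
     by rewrite -(addKr x y) -zE addrC; apply: memvB => //; apply: Mp.
  have {}vE : v = y + x + l by rewrite vE zE; apply/rowP=> i; rewrite !mxE;
    ring.
  have TvE : T v = y + T l + T x.
    by rewrite vE !TD Tfix//; apply/rowP=> i; rewrite !mxE; ring.
  rewrite TvE vE; apply/idP/idP=> [|Hv].
    move/(main _ _ _ yL yM (TLM _ lL) (TML _ xM)).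
    by rewrite !TK addrAC.
  by rewrite addrAC; apply: main.
move=> yL yM xM lL Hv.
have TxL := TML x xM; have TlM := TLM l lL.
(* For Q x = Q l the invariance of H under isometries of L and M suffices. *)
have [Qxl|Qxl] := eqVneq (Q x) (Q l).
  have yTxM : y + T x \in perp Q M by apply: memvD => //; apply: Lp.
  have yxL : y + x \in perp Q L by apply: memvD => //; apply: Mp.
  rewrite -(represents_norm ellM repM yTxM xM TlM) ?QT// addrAC.
  by rewrite -(represents_norm ellL repL yxL lL TxL) ?QT.
have sepL z : z \in L -> z \in perp Q L -> z = 0.
  by move=> zL /(perpP quadQ); apply: elliptic_nondeg.
have sepM z : z \in M -> z \in perp Q M -> z = 0.
  by move=> zM /(perpP quadQ); apply: elliptic_nondeg.
have TE0 a : (T a == 0) = (a == 0).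
  by rewrite -{1}(semilinear0 linT) (inj_eq (inv_inj TK)).
have yxL : y + x \in perp Q L by apply: memvD => //; apply: Mp.
have ylM : y + l \in perp Q M by apply: memvD => //; apply: Lp.
have perp_yx : B y x = 0 by apply: (perpP quadQ _ _ yM).
have perp_yl : B y l = 0 by apply: (perpP quadQ _ _ yL).
have perp_yTx : B y (T x) = 0 by apply: (perpP quadQ _ _ yL).
have perp_yTl : B y (T l) = 0 by apply: (perpP quadQ _ _ yM).
have ovoidL z : z \in M -> z != 0 -> B y z = 0 -> O y -> O (y + z) -> False.
  move=> zM z_neq0 yz Oy Oyz.
  have /vlineP[k kE] : y + z \in <[y]>%VS.
    apply: ovO => //; first by apply: memvD => //; apply: Mp.
    by rewrite polarDr// polarvv// yz addr0.
  case/negP: z_neq0; apply/eqP; apply: sepM => //.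
  by rewrite -(addKr y z) kE addrC memvB ?memvZ.
have ovoidM z : z \in L -> z != 0 -> B y z = 0 -> O' y -> O' (y + z) -> False.
  move=> zL z_neq0 yz Oy Oyz.
  have /vlineP[k kE] : y + z \in <[y]>%VS.
    apply: ovO' => //; first by apply: memvD => //; apply: Lp.
    by rewrite polarDr// polarvv// yz addr0.
  case/negP: z_neq0; apply/eqP; apply: sepL => //.
  by rewrite -(addKr y z) kE addrC memvB ?memvZ.
have [l0|l_neq0] := eqVneq l 0.
  have x_neq0 : x != 0 by apply: contra_neq Qxl => ->; rewrite l0.
  have Tx_neq0 : T x != 0 by rewrite TE0.
  have yx_neq0 : y + x != 0 by rewrite (perp_add_eq0 ellM)// negb_and x_neq0
    orbT.
  have yTx_neq0 : y + T x != 0.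
    by rewrite (perp_add_eq0 ellL)// negb_and Tx_neq0 orbT.
  move: Hv; rewrite l0 addr0 (semilinear0 linT) addr0 => Hv.
  move: (Hv); rewrite (represents_off ellM repM)// => /andP[/eqP Qyx O'y].
  rewrite (represents_off ellL repL)// QT /= Qyx eqxx /=.
  apply: contraT => NOy.
  have NH : ~~ H (y + T x) by rewrite (represents_off ellL repL)// negb_and NOy
    orbT.
  have yTxM : y + T x \in perp Q M by apply: memvD => //; apply: Lp.
  move: NH; rewrite (represents_on repM)// quadD// perp_yTx QT /= Qyx addr0.
  rewrite (addrr_pchar2 (pchar2_of_even F_even)) eqxx negbK => O'yTx.
  by case: (ovoidM (T x)).
have yl_neq0 : y + l != 0 by rewrite (perp_add_eq0 ellL)// negb_and l_neq0 orbT.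
have [x0|x_neq0] := eqVneq x 0.
  have Tl_neq0 : T l != 0 by rewrite TE0.
  have yTlL : y + T l \in perp Q L by apply: memvD => //; apply: Mp.
  move: Hv; rewrite x0 (semilinear0 linT) !addr0 => Hv.
  move: (Hv); rewrite (represents_off ellL repL)// => /andP[/eqP Qyl Oy].
  rewrite (represents_on repL)//; last first.
    by rewrite (perp_add_eq0 ellM)// negb_and Tl_neq0 orbT.
  rewrite quadD// perp_yTl QT /= Qyl addr0.
  rewrite (addrr_pchar2 (pchar2_of_even F_even)) eqxx /=.
  by apply/negP=> OyTl; case: (ovoidL (T l)).
exfalso.
move: (Hv); rewrite (represents_off ellL repL)// => /andP[/eqP Qyxl Oyx].
move: Hv; rewrite addrAC (represents_off ellM repM)// => /andP[_ O'yl].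
move: Qyxl; rewrite quadD// perp_yx addr0 => Qyxl.
have NOy : ~~ O y by apply/negP => Oy; apply: (ovoidL x).
have [Ql Qx] : Q l != 0 /\ Q x != 0.
  by split; [apply: contra_neq l_neq0|apply: contra_neq x_neq0];
    [case: ellL => _|case: ellM => _]; apply.
have [d d2] := square_root_char2 F_even (Q y / Q l).
have Qdl : Q (d *: l) = Q y by rewrite quadZ// d2 divfK.
have Qy : Q y != 0 by apply: contra_neq Qxl => y0; rewrite -Qyxl y0 add0r.
have dl_neq0 : d *: l != 0.
  by apply: contra_neq Qy => dl0; rewrite -Qdl dl0 quad0.
have dlL : d *: l \in L by apply: memvZ.
have NH : ~~ H (y + d *: l).
  by rewrite (represents_off ellL repL)// negb_and NOy orbT.
have ydlM : y + d *: l \in perp Q M by apply: memvD => //; apply: Lp.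
move: NH; rewrite (represents_on repM)//; last first.
  by rewrite (perp_add_eq0 ellL)// negb_and dl_neq0 orbT.
rewrite quadD// polarZr// perp_yl Qdl mulr0 addr0.
rewrite (addrr_pchar2 (pchar2_of_even F_even)) eqxx negbK => O'ydl.
have /vlineP[k kE] : y + d *: l \in <[y + l]>%VS.
  apply: ovO' => //.
  by rewrite !(polarE quadQ) !polarvv// (polarC _ l) perp_yl !mulr0 !addr0.
have yE : (1 - k) *: y = (k - d) *: l.
  apply/eqP; rewrite -subr_eq0; apply/eqP.
  transitivity (y + d *: l - k *: (y + l)); last by rewrite kE subrr.
  by apply/rowP=> i; rewrite !mxE; ring.
have : (1 - k) *: y = 0.
  by apply: sepL; [rewrite yE|]; apply: memvZ.
move/eqP; rewrite scaler_eq0 => /orP[|/eqP y0]; last first.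
  by rewrite y0 quad0 ?eqxx in Qy.
rewrite subr_eq0 => /eqP k1; move: yE; rewrite -k1 subrr scale0r => /esym/eqP.
rewrite scaler_eq0 (negPf l_neq0) orbF subr_eq0 => /eqP d1.
move: Qdl Qyxl; rewrite -d1 scale1r => -> /eqP.
by rewrite -subr_eq0 addrAC subrr add0r (negPf Qx).
Qed.

End Even.
End Represents.

(** * Groups of isometries *)

Section IsometryGroups.
Context {F : finFieldType} {n : nat} (Q : 'rV[F]_n -> F).
Context (quadQ : quadratic_form Q) (F_even : ~~ odd #|F|).
Implicit Types (U L M W : {vspace 'rV[F]_n}) (u v w x y : 'rV[F]_n).
Implicit Types (O H : pred 'rV[F]_n) (g : {perm 'rV[F]_n}).
Local Notation B := (polar_form Q).

Definition isometry_perm g : bool :=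
  [forall a : F, forall x, forall y, g (a *: x + y) == a *: g x + g y] &&
  [forall v, Q (g v) == Q v].

Lemma isometry_permP g : reflect (semi_isometry Q idfun g) (isometry_perm g).
Proof.
apply: (iffP andP) => [[/forallP lin /forallP Qg]|[lin Qg]]; split.
- by move=> a x y; have /forallP/(_ x)/forallP/(_ y)/eqP := lin a.
- by move=> v; apply/eqP/Qg.
- by apply/forallP=> a; apply/forallP=> x; apply/forallP=> y; apply/eqP/lin.
- by apply/forallP=> v; apply/eqP/Qg.
Qed.

Lemma isometry_perm1 : isometry_perm 1.
Proof. by apply/isometry_permP; split=> [a x y|v]; rewrite !perm1. Qed.

Lemma isometry_permM g1 g2 : isometry_perm g1 -> isometry_perm g2 ->
  isometry_perm (g1 * g2)%g.
Proof.
move=> /isometry_permP[lin1 Q1] /isometry_permP[lin2 Q2].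
apply/isometry_permP; split=> [a x y|v]; first by rewrite !permM lin1 lin2.
by rewrite permM Q2 Q1.
Qed.

Definition pointwise_isometries L : {set {perm 'rV[F]_n}} :=
  [set g | [&& isometry_perm g, [forall l in L, g l \in L] &
            [forall x in perp Q L, g x == x]]].

Lemma pointwise_isometriesP L g :
  reflect [/\ semi_isometry Q idfun g, {in L, forall l, g l \in L} &
              {in perp Q L, forall x, g x = x}] (g \in pointwise_isometries L).
Proof.
rewrite inE; apply: (iffP and3P) => -[/isometry_permP isog gL gx]; split=> //.
- by move=> l; apply/implyP/(forallP gL).
- by move=> x xL; apply/eqP; move: x xL; apply/forall_inP.
- by apply/forall_inP.
- by apply/forall_inP => x /gx->.
Qed.

Lemma pointwise_isometries_group_set L : group_set (pointwise_isometries L).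
Proof.
apply/group_setP; split=> [|g1 g2].
  apply/pointwise_isometriesP; split=> [|l|x _]; rewrite ?perm1//.
  exact/isometry_permP/isometry_perm1.
move=> /pointwise_isometriesP[/isometry_permP iso1 L1 x1].
move=> /pointwise_isometriesP[/isometry_permP iso2 L2 x2].
apply/pointwise_isometriesP; split.
- exact/isometry_permP/isometry_permM.
- by move=> l lL; rewrite permM; apply/L2/L1.
- by move=> x xL; rewrite permM x1 ?x2.
Qed.
Canonical pointwise_isometries_group L := Group (pointwise_isometries_group_set
  L).

Definition stabilizer_isometries H W : {set {perm 'rV[F]_n}} :=
  [set g | [&& isometry_perm g, [forall v, H (g v) == H v] &
            [forall w in W, g w \in W]]].

Lemma stabilizer_isometriesP H W g :
  reflect [/\ semi_isometry Q idfun g, forall v, H (g v) = H v &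
              {in W, forall w, g w \in W}] (g \in stabilizer_isometries H W).
Proof.
rewrite inE; apply: (iffP and3P) => -[/isometry_permP isog gH gW]; split=> //.
- by move=> v; apply/eqP/(forallP gH).
- by move=> w; apply/implyP/(forallP gW).
- by apply/forallP=> v; apply/eqP.
- by apply/forall_inP.
Qed.

Lemma stabilizer_isometries_group_set H W : group_set (stabilizer_isometries H
  W).
Proof.
apply/group_setP; split=> [|g1 g2].
  apply/stabilizer_isometriesP; split=> [|v|w]; rewrite ?perm1//.
  exact/isometry_permP/isometry_perm1.
move=> /stabilizer_isometriesP[/isometry_permP iso1 H1 W1].
move=> /stabilizer_isometriesP[/isometry_permP iso2 H2 W2].
apply/stabilizer_isometriesP; split.
- exact/isometry_permP/isometry_permM.
- by move=> v; rewrite permM H2 H1.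
- by move=> w wW; rewrite permM; apply/W2/W1.
Qed.
Canonical stabilizer_isometries_group H W := Group
  (stabilizer_isometries_group_set H W).

Lemma pointwise_sub_stabilizer L O H W : elliptic_line Q L -> represents Q L O
  H ->
  (L <= W)%VS -> pointwise_isometries L \subset stabilizer_isometries H W.
Proof.
move=> ellL repH /subvP LW; apply/fintype.subsetP=> g.
move=> /pointwise_isometriesP[[lin Qg] gL gx]; apply/stabilizer_isometriesP.
have gE v : exists2 l, l \in L & exists2 x, x \in perp Q L & v = x + l /\ g v =
  x + g l.
  have [l lL [x xL ->]] := perp_split quadQ v (elliptic_nondeg quadQ F_even
    ellL).
  exists l => //; exists x => //; rewrite addrC; split=> //.
  by rewrite (semilinearD lin) gx.
split=> // [v|w wW].
  have [l lL [x xL [-> ->]]] := gE v.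
  by apply: (represents_norm quadQ F_even ellL repH) => //; apply: gL.
have [l lL [x xL [wE ->]]] := gE w.
have -> : x + g l = w - l + g l by rewrite wE addrK.
by apply: memvD; [apply: memvB => //|]; apply: LW => //; apply: gL.
Qed.

Definition unit_vectors L := [set u | (u \in L) && (Q u == 1)].

Lemma card_unit_vectors L : elliptic_line Q L -> #|unit_vectors L| = #|F|.+1.
Proof.
case=> dimL anL; have q_gt1 := finNzRing_gt1 F.
pose f (ua : 'rV[F]_n * F) := ua.2 *: ua.1.
have f_inj : {in finset.setX (unit_vectors L) [set~ 0] &, injective f}.
  move=> [u a] [w b]; rewrite !inE /f /= => /andP[/andP[_ /eqP Qu] a0].
  move=> /andP[/andP[_ /eqP Qw] b0] abE.
  have [E|] : a = b \/ a != b by case: eqVneq; [left|right].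
    by move: abE; rewrite E => /(scalerI b0)->.
  have : Q (a *: u) = Q (b *: w) by rewrite abE.
  rewrite !quadZ// Qu Qw !mulr1 => /eqP; rewrite eqf_sqr.
  by rewrite (oppr_pchar2 (pchar2_of_even F_even)) orbb => ->.
have := card_in_imset f_inj; rewrite cardsX cardsC1.
have -> : f @: finset.setX (unit_vectors L) [set~ 0] = [set v | v \in L] :\ 0.
  apply/finset.setP=> v; rewrite !inE; apply/imsetP/andP=> [[[u a]]|[v0 vL]].
    rewrite !inE /f /= => /andP[/andP[uL /eqP Qu] a0] ->.
    rewrite memvZ// scaler_eq0 negb_or a0; split=> //.
    by apply/eqP=> u0; move: Qu; rewrite u0 quad0// => /eqP;
      rewrite eq_sym oner_eq0.
  have Qv : Q v != 0 by apply: contra_neq v0 => /(anL v vL).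
  have [d d2] := square_root_char2 F_even (Q v).
  have d0 : d != 0 by apply: contra_neq Qv => d0; rewrite -d2 d0 expr0n.
  exists (d^-1 *: v, d); last by rewrite /f /= scalerA divff ?scale1r.
  by rewrite !inE /= memvZ// d0 andbT quadZ// exprVn d2 mulVf ?eqxx.
have := cardsD1 0 [set v | v \in L]; rewrite inE mem0v cardsE card_vspace dimL.
case: #|F| q_gt1 => [//|q] q_gt0 cardL.
move=> cardE; apply/eqP; rewrite -(eqn_pmul2r (q_gt0 : 0 < q)%N) -cardE.
by rewrite -(eqn_add2l 1) -cardL; apply/eqP; rewrite expnS expn1; ring.
Qed.

Definition reflection s v := v - (B v s / Q s) *: s.

Lemma reflection_semi_isometry s : Q s != 0 -> semi_isometry Q idfun
  (reflection s).
Proof.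
move=> Qs; split=> [a x y|v].
  by apply/rowP=> i; rewrite !mxE !(polarE quadQ) /=; ring.
rewrite /reflection !(quadE quadQ) !(polarE quadQ) /= exprMn exprVn.
by field.
Qed.

Lemma reflectionK s : Q s != 0 -> involutive (reflection s).
Proof.
move=> Qs v; rewrite /reflection !(polarE quadQ) polarvv// mulr0 subr0.
apply/rowP=> i; rewrite !mxE.
by apply: (eq_mod2 F_even (k := - (B v s / Q s) * s 0 i)); ring.
Qed.

Lemma pointwise_isometries_trans L u w : elliptic_line Q L ->
    u \in L -> w \in L -> Q u = Q w -> 
  exists2 g, g \in pointwise_isometries L & g u = w.
Proof.
move=> [dimL anL] uL wL Quw.
have [->|uw] := eqVneq u w; first by exists 1%g; rewrite ?group1 ?perm1.
pose s := u - w; have sL : s \in L by apply: memvB.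
have Qs : Q s != 0.
  by apply: contra_neq uw => /(anL _ sL)/eqP; rewrite subr_eq0 => /eqP.
exists (perm (can_inj (reflectionK Qs))); last first.
  rewrite permE /reflection.
  have -> : B u s = Q s.
    rewrite /s polarDr// polarNr// polarvv// add0r quadD// quadN// polarNr//
      Quw.
    by apply: (eq_mod2 F_even (k := - Q w)); ring.
  by rewrite divff// scale1r /s opprB addrC subrK.
have [lin Qr] := reflection_semi_isometry Qs.
apply/pointwise_isometriesP; split.
- by split=> [a x y|v]; rewrite !permE.
- by move=> l lL; rewrite permE memvB// memvZ.
- by move=> x xL; rewrite permE /reflection (perpP quadQ _ _ xL)// mul0r
  scale0r subr0.
Qed.

Lemma dvdn_pointwise_isometries L : elliptic_line Q L ->
  (#|F|.+1 %| #|pointwise_isometries L|)%N.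
Proof.
move=> ellL; have [dimL anL] := ellL.
have [u [w [uL _ Qu _ _]]] := normalized_basis_exists quadQ F_even dimL anL.
suff E : orbit 'P (pointwise_isometries L) u = unit_vectors L.
  by rewrite -(card_unit_vectors ellL) -E card_orbit dvdn_indexg.
apply/finset.setP=> v; rewrite inE; apply/orbitP/andP.
  case=> g /pointwise_isometriesP[[_ Qg] gL _] <-;
    change ('P%act u g) with (g u).
  by rewrite gL// Qg Qu /= eqxx.
case=> vL /eqP Qv.
have [|g gR gu] := pointwise_isometries_trans ellL uL vL;
  first by rewrite Qu Qv.
by exists g.
Qed.

(* An isometry of L fixing a nonzero vector of L is an involution. *)
Lemma fixed_point_free_isometry L g : elliptic_line Q L ->
    g \in pointwise_isometries L -> odd #[g]%g -> g != 1%g ->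
  {in L, forall y, g y = y -> y = 0}.
Proof.
move=> ellL /pointwise_isometriesP[isog gL gx] odd_g g_neq1 y yL gy.
have [lin Qg] := isog; have [dimL anL] := ellL.
apply: contra_neq_eq g_neq1 => y_neq0.
suff g2 : (g ^+ 2 = 1)%g.
  have : (#[g]%g %| 2)%N by rewrite order_dvdn g2.
  rewrite dvdn_divisors// !inE => /orP[/eqP|/eqP g_order]; first by move/eqP;
    rewrite order_eq1 => /eqP.
  by rewrite g_order in odd_g.
have g2L z : z \in L -> g (g z) = z.
  move=> zL; pose d := g z - z.
  have dL : d \in L by rewrite memvB ?gL.
  have Byd : B y d = 0.
    by rewrite polarDr// polarNr// -{1}gy (semi_isometry_polar _ _ isog) subrr.
  have /vlineP[k dE] : d \in <[y]>%VS.
    apply: (contraNT _ y_neq0) => /(line2_span dimL yL dL y_neq0) span.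
    apply/eqP; apply: (elliptic_nondeg quadQ F_even ellL) => // w /span[a [b
      ->]].
    by rewrite polarDr// !polarZr// polarvv// Byd !mulr0 addr0.
  have gz : g z = k *: y + z by rewrite -dE subrK.
  rewrite gz lin gz gy; apply/rowP=> i; rewrite !mxE /=.
  by apply: (eq_mod2 F_even (k := k * y 0 i)); ring.
apply/permP=> v; rewrite perm1 expgS expg1 permM.
have [l lL [x xL ->]] := perp_split quadQ v (elliptic_nondeg quadQ F_even ellL).
by rewrite !(semilinearD lin) g2L// !gx.
Qed.

Lemma prime_order_isometry L r : elliptic_line Q L -> prime r ->
    (r %| #|F|.+1)%N ->
  exists g, [/\ g \in pointwise_isometries L, #[g]%g = r &
                {in L, forall y, g y = y -> y = 0}].
Proof.
move=> ellL r_pr r_dvd.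
have [g gR g_order] := Cauchy r_pr (dvdn_trans r_dvd (dvdn_pointwise_isometries
  ellL)).
exists g; split=> //; apply: fixed_point_free_isometry => //.
  rewrite g_order; have : odd #|F|.+1 by [].
  by apply: dvdn_odd.
by rewrite -order_eq1 g_order; case: r r_pr {r_dvd g_order} => [|[|]].
Qed.

(* A 2-dimensional subspace is given as the set T of its vectors, so that orbits
   can be counted in {set 'rV[F]_n}. *)
Lemma fixed_line_dichotomy L g (T : {set 'rV[F]_n}) : elliptic_line Q L ->
    g \in pointwise_isometries L -> {in L, forall y, g y = y -> y = 0} ->
    (forall a x y, x \in T -> y \in T -> a *: x + y \in T) ->
    #|T| = (#|F| ^ 2)%N -> {in T, forall x, g x \in T} ->
  T = [set v | v \in L] \/ {in T, forall v, v \in perp Q L}.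
Proof.
move=> ellL /pointwise_isometriesP[isog gL gx] free_g linT cardT gT.
have [lin Qg] := isog; have [dimL anL] := ellL.
have [[x xT xNL]|all] := pselect (exists2 x, x \in T & x \notin perp Q L);
  last first.
  right=> v vT; apply: contrapT => /negP vN; apply: all; by exists v.
left; have [l lL [z zL xE]] := perp_split quadQ x (elliptic_nondeg quadQ F_even
  ellL).
have l_neq0 : l != 0 by apply: contraNneq xNL => l0; rewrite xE l0 add0r.
pose y := g l - l; have yL : y \in L by rewrite memvB ?gL.
have yT : y \in T.
  have -> : y = (-1) *: x + g x.
    rewrite xE (semilinearD lin) (gx z zL) /y.
    by apply/rowP=> i; rewrite !mxE; ring.
  by apply: linT => //; apply: gT.
have y_neq0 : y != 0.
  by apply: contra_neq l_neq0 => /eqP; rewrite subr_eq0 => /eqP; apply: free_g.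
have gyN : g y \notin <[y]>%VS.
  apply/negP=> /vlineP[k gy]; have : Q (g y) = Q y := Qg y.
  have Qy : Q y != 0 by apply: contra_neq y_neq0; apply: anL.
  rewrite gy quadZ// -{2}[Q y]mul1r => /(mulIf Qy)/eqP.
  rewrite -(expr1n _ 2) eqf_sqr (oppr_pchar2 (pchar2_of_even F_even)) orbb.
  move/eqP=> k1; case/negP: y_neq0; apply/eqP/free_g => //.
  by rewrite gy k1 scale1r.
apply/esym/eqP; rewrite eqEcard cardT cardsE card_vspace dimL leqnn andbT.
have T0 : 0 \in T.
  by rewrite -(addNr y) -scaleN1r; apply: linT.
apply/fintype.subsetP=> v; rewrite inE => vL.
have [a [b ->]] := line2_span dimL yL (gL _ yL) y_neq0 gyN vL.
apply: (linT) => //; rewrite -[b *: _]addr0; apply: linT => //; exact: gT.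
Qed.

End IsometryGroups.

(** * Conjugacy of the lines representing a hyperoval *)

Section Conjugacy.
Context {F : finFieldType} {n : nat} (Q : 'rV[F]_n -> F).
Context (quadQ : quadratic_form Q) (F_even : ~~ odd #|F|).
Implicit Types (U L M W : {vspace 'rV[F]_n}) (u v w x y : 'rV[F]_n).
Implicit Types (O H : pred 'rV[F]_n) (g : {perm 'rV[F]_n}).
Local Notation B := (polar_form Q).

Lemma swap_exists L M O O' H :
    elliptic_line Q L -> elliptic_line Q M -> (M <= perp Q L)%VS ->
    represents Q L O H -> represents Q M O' H ->
    partial_ovoid Q (perp Q L) O -> partial_ovoid Q (perp Q M) O' ->
  exists g, [/\ semi_isometry Q idfun g, forall v, H (g v) = H v &
                forall v, (g v \in M) = (v \in L)].
Proof.
move=> ellL ellM perpML repL repM ovO ovO'.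
have [dimL anL] := ellL; have [dimM anM] := ellM.
have [u [w basL]] := normalized_basis_exists quadQ F_even dimL anL.
have [u' [w0 basM0]] := normalized_basis_exists quadQ F_even dimM anM.
have [k kE] := artin_schreier_sum F_even
  (normalized_basis_no_root quadQ F_even anM basM0)
  (normalized_basis_no_root quadQ F_even anL basL).
have [] := normalized_basis_shift quadQ F_even k basM0.
rewrite {}kE; move: (w0 + _) => w' {w0 basM0} basM Qw'.
have [uL wL Qu Buw LE] := basL; have [uM wM Qu' Buw' ME] := basM.
have BLM l m : l \in L -> m \in M -> B m l = 0.
  by move=> lL mM; apply: (perpP quadQ _ _ (subvP perpML m mM)).
have BLM' l m : l \in L -> m \in M -> B l m = 0.
  by move=> lL mM; rewrite polarC BLM.
pose t := u - u'; pose r := w - w'.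
have one2 (a : F) : a = a * -1 by apply: (eq_mod2 F_even (k := a)); ring.
have Qt : Q t = 0.
  by rewrite quadD// quadN// polarNr// BLM'// Qu Qu' oppr0 addr0 (addrr_pchar2
    (pchar2_of_even F_even)).
have Qr : Q r = 0.
  by rewrite quadD// quadN// polarNr// BLM'// Qw' oppr0 addr0 (addrr_pchar2
    (pchar2_of_even F_even)).
have Btr : B t r = 0.
  rewrite !(polarE quadQ) Buw Buw' (BLM w u')// (BLM' u w')//.
  by apply: (eq_mod2 F_even (k := 1)); ring.
have isoT := swap_semi_isometry quadQ Qt Qr Btr.
have TK := swapK quadQ F_even Qt Qr Btr.
have TLM : {in L, forall l, swap Q t r l \in M}.
  move=> l lL; rewrite /swap.
  have -> : B l t = B l u by rewrite /t polarDr// polarNr// (BLM' l u')// subr0.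
  have -> : B l r = B l w by rewrite /r polarDr// polarNr// (BLM' l w')// subr0.
  suff -> : l + B l w *: t - B l u *: r = B l w *: u' + B l u *: w'.
    by rewrite memvD// memvZ.
  rewrite {1}(LE l lL); apply/rowP=> i; rewrite !mxE.
  apply: (eq_mod2 F_even (k := B l w * u 0 i - B l w * u' 0 i)); ring.
have TML : {in M, forall x, swap Q t r x \in L}.
  move=> l lM; rewrite /swap.
  have -> : B l t = - B l u' by rewrite /t polarDr// polarNr// (BLM u l)//
    sub0r.
  have -> : B l r = - B l w' by rewrite /r polarDr// polarNr// (BLM w l)//
    sub0r.
  suff -> : l + - B l w' *: t - - B l u' *: r = B l w' *: u + B l u' *: w.
    by rewrite memvD// memvZ.
  rewrite {1}(ME l lM); apply/rowP=> i; rewrite !mxE.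
  apply: (eq_mod2 F_even (k := B l w' * u' 0 i - B l w' * u 0 i)); ring.
have Tfix : {in perp Q L, forall y, y \in perp Q M -> swap Q t r y = y}.
  move=> y /(perpP quadQ) yL /(perpP quadQ) yM.
  by rewrite /swap !(polarE quadQ) (yL u)// (yL w)// (yM u')// (yM w')// !subr0
    !scale0r addr0 subr0.
have HT := swap_represents quadQ F_even ellL ellM perpML repL repM ovO ovO'
  isoT TK TLM TML Tfix.
exists (perm (inv_inj TK)); split=> [|v|v].
- by case: isoT => lin QT; split=> [a x y|v]; rewrite !permE.
- by rewrite permE.
- by rewrite permE; apply/idP/idP=> [/TML|/TLM//]; rewrite TK.
Qed.

(* Let G consist of the isometries that preserve H and W = L + L'. If no G-image
   of L' is L or orthogonal to L, then an isometry of odd prime order r dividing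
   q + 1 that rotates L and centralizes its perp fixes no G-image of L', whereas
   such a rotation of L' fixes one or two of them; but both numbers of fixed
   images are congruent modulo r to the size of the orbit. *)
Lemma represents_conjugate L L' O O' H :
    elliptic_line Q L -> elliptic_line Q L' ->
    represents Q L O H -> represents Q L' O' H ->
    partial_ovoid Q (perp Q L) O -> partial_ovoid Q (perp Q L') O' ->
  exists g, [/\ semi_isometry Q idfun g, forall v, H (g v) = H v &
                forall v, (g v \in L) = (v \in L')].
Proof.
move=> ellL ellL' repL repL' ovO ovO'.
have [dimL anL] := ellL; have [dimL' anL'] := ellL'.
pose W := (L + L')%VS; pose G := stabilizer_isometries_group Q H W.
pose set_of (U : {vspace 'rV[F]_n}) := [set v | v \in U].
pose S := orbit ('P^*)%act G (set_of L').
have SP T : T \in S -> exists2 g, g \in G & T = g @: set_of L'.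
  by case/orbitP=> g gG <-; exists g.
have [[g gG gL']|noL] := pselect (exists2 g, g \in G & g @: set_of L' = set_of
  L).
  move/stabilizer_isometriesP: gG => [isog gH _]; exists g; split=> // v.
  have -> : (g v \in L) = (g v \in set_of L) by rewrite inE.
  by rewrite -gL' mem_imset ?inE//; apply: perm_inj.
have [[g gG gL']|noperp] := pselect (exists2 g, g \in G &
    {in g @: set_of L', forall v, v \in perp Q L}).
  move/stabilizer_isometriesP: gG => [isog gH _].
  have gK : cancel g (g^-1)%g by move=> v; rewrite permK.
  have gVK : cancel (g^-1)%g g by move=> v; rewrite permKV.
  pose M := semilinear_img g L'; have [lin Qg] := isog.
  have ellM : elliptic_line Q M.
    split; last exact: anisotropic_img isog anL'.
    by rewrite (dim_semilinear_img lin)//; apply: perm_inj.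
  have MML : (M <= perp Q L)%VS.
    apply/subvP=> _ /(semilinear_imgP lin)[u uL' ->].
    by apply: gL'; rewrite imset_f ?inE.
  have repM : represents Q M (O' \o (g^-1)%g) H.
    have := represents_img quadQ isog gK gVK repL'.
    by move=> repM x l xM lM /repM-/(_ xM lM) <-; rewrite /= -{1}[x + l]gVK gH.
  have ovM := partial_ovoid_img quadQ isog gK gVK ovO'.
  have [h [isoh hH hM]] := swap_exists ellL ellM MML repL repM ovO ovM.
  pose A := stabilizer_isometries_group Q H fullv.
  have inA (k : {perm 'rV[F]_n}) :
      semi_isometry Q idfun k -> (forall v, H (k v) = H v) -> k \in A.
    by move=> isok kH; apply/stabilizer_isometriesP; split=> // v _;
      apply: memvf.
  have : (g * h^-1)%g \in A by rewrite groupM ?groupV ?inA.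
  case/stabilizer_isometriesP=> isogh ghH _; exists (g * h^-1)%g; split=> // v.
  rewrite -hM permM permKV; apply/(semilinear_imgP lin)/idP=> [[u uL'
    /perm_inj->//]|vL'].
  by exists v.
exfalso; pose r := pdiv #|F|.+1.
have r_pr : prime r by apply: pdiv_prime; rewrite ltnS (cardD1 0).
have r_dvd : (r %| #|F|.+1)%N := pdiv_dvd _.
have r_gt2 : (2 < r)%N.
  rewrite odd_prime_gt2//; apply: dvdn_odd r_dvd _.
  by rewrite /= F_even.
have actG : [acts G, on S | ('P^*)%act] by apply: acts_orbit;
  apply: finset.subsetT.
have fix_mod M OM g : elliptic_line Q M -> represents Q M OM H -> (M <= W)%VS ->
    g \in pointwise_isometries Q M -> #[g]%g = r ->
    #|S| = #|('Fix_(S | 'P^*)(<[g]>))%g| %[mod r].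
  move=> ellM repM MW gM g_order; apply: pgroup_fix_mod.
    by rewrite /pgroup -[#|_|]/(#[g]%g) g_order pnat_id.
  apply: (fintype.subset_trans _ actG); rewrite cycle_subG.
  by apply: (fintype.subsetP (pointwise_sub_stabilizer quadQ F_even ellM repM
    MW)).
have fixP g T : T \in ('Fix_(S | 'P^*)(<[g]>))%g ->
    T \in S /\ {in T, forall x, g x \in T}.
  rewrite inE afix_cycle => /andP[TS /afix1P gT]; split=> // x xT.
  by rewrite -[T]gT; apply: (imset_f (aperm^~ g)).
have S_lin T : T \in S ->
    [/\ forall a x y, x \in T -> y \in T -> a *: x + y \in T,
        #|T| = (#|F| ^ 2)%N & {in T, forall x, x \in W}].
  case/SP=> g /stabilizer_isometriesP[[lin _] _ gW] ->; split.
  - move=> a _ _ /imsetP[x xL ->] /imsetP[y yL ->].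
    rewrite -lin; apply: imset_f; rewrite !inE in xL yL *.
    by rewrite memvD ?memvZ.
  - by rewrite card_imset ?cardsE ?card_vspace ?dimL'//; apply: perm_inj.
  - move=> _ /imsetP[x xL ->]; apply: gW; rewrite inE in xL.
    by apply: (subvP (addvSr _ _)).
have LW : (L <= W)%VS := addvSl _ _.
have LW' : (L' <= W)%VS := addvSr _ _.
have [g [gL g_order g_free]] := prime_order_isometry quadQ F_even ellL r_pr
  r_dvd.
have [g' [gL' g'_order g'_free]] := prime_order_isometry quadQ F_even ellL'
  r_pr r_dvd.
have fix0 : ('Fix_(S | 'P^*)(<[g]>))%g = finset.set0.
  apply/finset.setP=> T; rewrite finset.in_set0; apply/negP=> /fixP[TS gT].
  have [linT cardT TW] := S_lin T TS; have [h hG TE] := SP T TS.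
  have := fixed_line_dichotomy quadQ F_even ellL gL g_free linT cardT gT.
  by rewrite TE => -[hL|hL]; [apply: noL|apply: noperp]; exists h.
pose P := (W :&: perp Q L')%VS.
have dimP : (\dim P <= 2)%N.
  have cap0 : (L' :&: P = 0)%VS.
    apply/eqP; rewrite -subv0 -(cap_perp_nondeg quadQ (elliptic_nondeg quadQ
      F_even ellL')).
    by rewrite capvS// capvSr.
  have : (\dim (L' + P) <= \dim W)%N.
    by apply: dimvS; rewrite subv_add LW' capvSl.
  rewrite (dimv_disjoint_sum cap0) dimL' => le1.
  have : (\dim W <= 2 + 2)%N.
    by rewrite -[X in (X + _)%N]dimL -[X in (_ + X)%N]dimL';
      apply: dimv_add_leqif.
  by move/(leq_trans le1); rewrite leq_add2l.
have fix2 : ('Fix_(S | 'P^*)(<[g']>))%g \subset [set set_of L'; set_of P].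
  apply/fintype.subsetP=> T /fixP[TS gT].
  have [linT cardT TW] := S_lin T TS.
  have [->|TL] := fixed_line_dichotomy quadQ F_even ellL' gL' g'_free linT
    cardT gT.
    by rewrite !inE eqxx.
  rewrite !inE; apply/orP; right; rewrite eqEcard cardT cardsE card_vspace.
  rewrite leq_exp2l ?finNzRing_gt1// dimP andbT.
  by apply/fintype.subsetP=> v vT; rewrite inE memv_cap TW// TL.
have L'_fix : set_of L' \in ('Fix_(S | 'P^*)(<[g']>))%g.
  rewrite inE afix_cycle orbit_refl; apply/afix1P/eqP.
  rewrite eqEcard card_imset ?leqnn ?andbT; last exact: perm_inj.
  apply/fintype.subsetP=> _ /imsetP[x xL ->]; rewrite !inE in xL *.
  by case/pointwise_isometriesP: gL' => _ + _; apply.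
have := fix_mod _ _ _ ellL repL LW gL g_order.
rewrite fix0 cards0 (fix_mod _ _ _ ellL' repL' LW' gL' g'_order) mod0n.
move=> fix_mod0; have : (r <= #|('Fix_(S | 'P^*)(<[g']>))%g|)%N.
  apply: dvdn_leq; first by apply/card_gt0P; exists (set_of L').
  by rewrite /dvdn fix_mod0.
apply/negP; rewrite -ltnNge; apply: leq_ltn_trans r_gt2.
by apply: leq_trans (subset_leq_card fix2) _; rewrite cards2 ltnS leq_b1.
Qed.

End Conjugacy.

(** * The fundamental theorem of projective geometry *)

Section FundamentalTheorem.
Context {F : finFieldType} {n : nat} (U : {vspace 'rV[F]_n}).
Context (f : {vspace 'rV[F]_n} -> {vspace 'rV[F]_n}).
Context (coll_f : collineation U f) (dimU : (2 < \dim U)%N).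
Implicit Types (c k : F) (a b u v w x y z : 'rV[F]_n).

Let R x y := [/\ x \in U, x != 0 & f <[x]> = <[y]>%VS].

Let R_ex x : x \in U -> x != 0 -> R x (vpick (f <[x]>%VS)).
Proof.
move=> xU x0; split=> //; have [[fU _ _] _] := coll_f.
have [_ dimp] := fU _ (points_vline xU x0).
apply/esym/eqP; rewrite eqEdim -memvE memv_pick dimp dim_vline.
by rewrite vpick0 -dimv_eq0 dimp.
Qed.

Let R_U x y : R x y -> y \in U /\ y != 0.
Proof.
case=> xU x0 fx; have [[fU _ _] _] := coll_f.
have [] := fU _ (points_vline xU x0); rewrite fx -memvE dim_vline => yU y1.
by split=> //; case: eqVneq y1.
Qed.

Let R_inj x x' y y' : R x x' -> R y y' -> (y' \in <[x']>%VS) = (y \in <[x]>%VS).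
Proof.
move=> Rx Ry; have [xU x0 fx] := Rx; have [yU y0 fy] := Ry.
have [_ x'0] := R_U Rx; have [_ y'0] := R_U Ry.
have [[_ f_inj _] _] := coll_f.
apply/idP/idP => [yx'|yx]; last first.
  by rewrite -fx -(vline_eq y0 yx) fy memv_line.
have := f_inj <[x]>%VS <[y]>%VS; rewrite fx fy (vline_eq y'0 yx').
move=> ->//; first exact: memv_line.
- by apply/mem_set/points_vline.
- by apply/mem_set/points_vline.
Qed.

Let R_line a a' b b' x x' : R a a' -> R b b' -> R x x' -> b \notin <[a]>%VS ->
  (x' \in <[a']> + <[b']>)%VS = (x \in <[a]> + <[b]>)%VS.
Proof.
move=> Ra Rb Rx bNa; have [aU a0 fa] := Ra; have [bU b0 fb] := Rb.
have [xU x0 fx] := Rx; have [_ a'0] := R_U Ra; have [_ x'0] := R_U Rx.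
have [[_ f_inj _] f_line] := coll_f.
have b'Na' : b' \notin <[a']>%VS by rewrite (R_inj Ra Rb).
have L_line : lines U (<[a]> + <[b]>)%VS.
  by split; rewrite ?dim_add_vline// subv_add -!memvE aU bU.
have [M [MU dimM] fM] := f_line _ L_line.
have MP z z' : R z z' -> z \in (<[a]> + <[b]>)%VS -> z' \in M.
  case=> zU z0 fz zL.
  have : points M (f <[z]>)%VS by rewrite -fM; exists <[z]>%VS => //;
    exact: points_vline.
  by rewrite fz => -[]; rewrite -memvE.
have ME : M = (<[a']> + <[b']>)%VS.
  apply/esym/eqP; rewrite eqEdim subv_add -!memvE dim_add_vline// dimM andbT.
  by rewrite (MP _ _ Ra) ?(MP _ _ Rb) ?memv_addl_line ?memv_addr_line.
rewrite -ME; apply/idP/idP=> [x'M|]; last exact: MP.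
have : points M (f <[x]>)%VS by rewrite fx; apply: points_vline.
rewrite -fM => -[p [pL dimp] fp].
have pE : p = <[x]>%VS.
  apply: f_inj => //; apply/mem_set; last exact: points_vline.
  by split=> //; apply: subv_trans pL _; case: L_line.
by rewrite memvE -pE.
Qed.

Let e0 := vpick U.

Let e0U : e0 \in U. Proof. exact: memv_pick. Qed.

Let e0_neq0 : e0 != 0.
Proof. by rewrite vpick0 -dimv_eq0; case: (\dim U) dimU. Qed.

Let w := vpick (f <[e0]>%VS).

Let Re0 : R e0 w. Proof. exact: R_ex. Qed.

Let E := (U :&: <[e0]>^C)%VS.

Let EU v : v \in E -> v \in U. Proof. by rewrite memv_cap => /andP[]. Qed.

Let E_e0 k v u : v \in E -> k *: e0 + u = v -> u \in E -> k = 0.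
Proof.
move=> vE kE uE; apply/eqP; have : k *: e0 \in (<[e0]> :&: <[e0]>^C)%VS.
  rewrite memv_cap memvZ ?memv_line//= -[_ *: _](addrK u) kE.
  by move: uE vE; rewrite !memv_cap => /andP[_ uE] /andP[_ vE]; apply: memvB.
by rewrite capv_compl memv0 scaler_eq0 (negPf e0_neq0) orbF.
Qed.

Let e0_add_neq0 v : v \in E -> e0 + v != 0.
Proof.
move=> vE; apply/eqP=> ev0; have := @E_e0 1 0 v (mem0v _).
by rewrite scale1r => /(_ ev0 vE)/eqP; rewrite oner_eq0.
Qed.

Let e0_notin v : v \in E -> e0 \notin <[v]>%VS.
Proof.
move=> vE; apply/negP=> /vlineP[k kE]; have := @E_e0 1 (k *: v) 0.
by rewrite scale1r addr0 memvZ// mem0v => /(_ isT kE isT)/eqP; rewrite oner_eq0.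
Qed.

Let notin_e0 v : v \in E -> v != 0 -> v \notin <[e0]>%VS.
Proof. by move=> vE v0; apply: contra (e0_notin vE) => /(vline_sym v0). Qed.

(* Faure's normalization: once f <e0> = <w>, each point <v> off <e0> has exactly
   one representative y of its image with f <e0 + v> = <w + y>. *)
Let P v y := (f <[v]>%VS == <[y]>%VS) && (f <[e0 + v]>%VS == <[w + y]>%VS).

Let PR v y : v \in E -> v != 0 -> P v y -> R v y /\ R (e0 + v) (w + y).
Proof.
move=> vE v0 /andP[/eqP fv /eqP fev]; split; split=> //; first exact: EU.
  exact: memvD e0U (EU vE).
exact: e0_add_neq0.
Qed.

Let P_ex v : v \in E -> v != 0 -> exists y, P v y.
Proof.
move=> vE v0; have Rv := R_ex (EU vE) v0; set y := vpick _ in Rv.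
have Rev := R_ex (memvD e0U (EU vE)) (e0_add_neq0 vE); set z := vpick _ in Rev.
have vNe0 := notin_e0 vE v0.
have : z \in (<[w]> + <[y]>)%VS.
  by rewrite (R_line Re0 Rv Rev vNe0) memv_add ?memv_line.
case/memv_addP=> _ /vlineP[c ->] [_ /vlineP[k ->] zE].
have c0 : c != 0.
  apply/eqP=> c0; move: zE; rewrite c0 scale0r add0r => zE.
  have : z \in <[y]>%VS by rewrite zE memvZ ?memv_line.
  rewrite (R_inj Rv Rev) => /vlineP[d evE].
  move/eqP: (oner_neq0 F); apply; apply: (@E_e0 _ (d *: v) v) => //.
    by rewrite memvZ.
  by rewrite scale1r.
have k0 : k != 0.
  apply/eqP=> k0; move: zE; rewrite k0 scale0r addr0 => zE.
  have : z \in <[w]>%VS by rewrite zE memvZ ?memv_line.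
  rewrite (R_inj Re0 Rev) => /vlineP[d evE].
  case/negP: vNe0; apply/vlineP; exists (d - 1).
  by rewrite scalerBl scale1r -evE addrC addKr.
exists ((c^-1 * k) *: y); have [_ _ fv] := Rv; have [_ _ fev] := Rev.
rewrite /P fv fev vline_scale ?mulf_neq0 ?invr_eq0// eqxx /=.
rewrite zE -(@vline_scale _ _ c^-1) ?invr_eq0//.
by rewrite scalerDr !scalerA mulVf ?scale1r.
Qed.

Let P_uniq v y y' : v \in E -> v != 0 -> P v y -> P v y' -> y = y'.
Proof.
move=> vE v0 /(PR vE v0)[Rv Rev] /(PR vE v0)[Rv' Rev'].
have [_ _ fv] := Rv; have [_ _ fv'] := Rv'.
have [_ _ fev] := Rev; have [_ _ fev'] := Rev'.
have /vlineP[k kE] : y' \in <[y]>%VS by rewrite -fv fv' memv_line.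
have /vlineP[c cE] : w + y' \in <[w + y]>%VS by rewrite -fev fev' memv_line.
have yNw : y \notin <[w]>%VS by rewrite (R_inj Re0 Rv) notin_e0.
have kc : k = c.
  apply/eqP; rewrite -subr_eq0; apply: contraNT yNw => kc.
  apply/vlineP; exists ((k - c)^-1 * (c - 1)).
  rewrite -scalerA (_ : (c - 1) *: w = (k - c) *: y) ?scalerA ?mulVf ?scale1r//.
  apply/eqP; rewrite -subr_eq0; apply/eqP.
  transitivity (c *: (w + y) - (w + k *: y)); last by rewrite -kE -cE subrr.
  by apply/rowP=> i; rewrite !mxE; ring.
suff c1 : c = 1 by rewrite kE kc c1 scale1r.
have [_ w0] := R_U Re0.
apply/eqP; rewrite -subr_eq0; have : (c - 1) *: w == 0.
  rewrite -(subrr (w + y')) {1}cE kE kc -subr_eq0; apply/eqP/rowP=> i.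
  by rewrite !mxE; ring.
by rewrite scaler_eq0 (negPf w0) orbF.
Qed.

Let phi v := if v == 0 then 0 else odflt 0 [pick y | P v y].

Let phi0 : phi 0 = 0. Proof. by rewrite /phi eqxx. Qed.

Let phiP v : v \in E -> v != 0 -> P v (phi v).
Proof.
move=> vE v0; rewrite /phi (negPf v0); case: pickP => //= none.
by have [y] := P_ex vE v0; rewrite none.
Qed.

Let phi_neq0 v : v \in E -> v != 0 -> phi v != 0.
Proof. by move=> vE v0; have [/R_U[]] := PR vE v0 (phiP vE v0). Qed.

Let indep u v c k d : u \in E -> v \in E -> u != 0 -> v \notin <[u]>%VS ->
  c *: w + k *: phi u + d *: phi v = 0 -> [/\ c = 0, k = 0 & d = 0].
Proof.
move=> uE vE u0 vNu eq0.
have v0 : v != 0 by apply: contraNneq vNu => ->; rewrite mem0v.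
have [Ru _] := PR uE u0 (phiP uE u0); have [Rv _] := PR vE v0 (phiP vE v0).
have c0 : c = 0.
  apply/eqP; apply: contraT => c0; exfalso.
  have : w \in (<[phi u]> + <[phi v]>)%VS.
    have -> : w = (- c^-1 * k) *: phi u + (- c^-1 * d) *: phi v.
      rewrite -!scalerA -scalerDr.
      have -> : k *: phi u + d *: phi v = - (c *: w).
        by apply/eqP; rewrite -addr_eq0 addrC addrA eq0.
      by rewrite scalerN scaleNr opprK scalerA mulVf ?scale1r.
    by rewrite memv_add ?memvZ ?memv_line.
  rewrite (R_line Ru Rv Re0 vNu) => /memv_addP[x /vlineP[c1 ->]].
  case=> _ /vlineP[c2 ->] e0E.
  move/eqP: (oner_neq0 F); apply; apply: (@E_e0 _ (c1 *: u + c2 *: v) 0).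
  - by rewrite memvD ?memvZ.
  - by rewrite scale1r addr0.
  - exact: mem0v.
move: eq0; rewrite c0 scale0r add0r => eq0.
have d0 : d = 0.
  apply/eqP; apply: contraT => d0; case/negP: vNu; rewrite -(R_inj Ru Rv).
  apply/vlineP; exists (- d^-1 * k); rewrite -scalerA.
  have -> : k *: phi u = - (d *: phi v) by apply/eqP; rewrite -addr_eq0 eq0.
  by rewrite scalerN scaleNr opprK scalerA mulVf ?scale1r.
move: eq0; rewrite d0 scale0r addr0 => /eqP.
by rewrite scaler_eq0 (negPf (phi_neq0 uE u0)) orbF => /eqP.
Qed.

Let phiD_indep u v : u \in E -> v \in E -> u != 0 -> v \notin <[u]>%VS ->
  phi (u + v) = phi u + phi v.
Proof.
move=> uE vE u0 vNu.
have v0 : v != 0 by apply: contraNneq vNu => ->; rewrite mem0v.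
have uvE : u + v \in E by apply: memvD.
have uv0 : u + v != 0.
  by apply: contraNneq vNu => /eqP; rewrite addrC addr_eq0 => /eqP->;
    rewrite memvN memv_line.
have [Ru Reu] := PR uE u0 (phiP uE u0); have [Rv Rev] := PR vE v0 (phiP vE v0).
apply: (P_uniq uvE uv0 (phiP uvE uv0)).
pose x := e0 + (u + v); have xU : x \in U := memvD e0U (EU uvE).
have Rx := R_ex xU (e0_add_neq0 uvE); set x' := vpick _ in Rx.
have Rz := R_ex (EU uvE) uv0; set z' := vpick _ in Rz.
have euN a b : a \in E -> b \in E -> b != 0 -> b \notin <[e0 + a]>%VS.
  move=> aE bE b0; apply/negP=> /(vline_sym b0)/vlineP[k kE].
  move/eqP: (oner_neq0 F); apply; apply: (@E_e0 _ (k *: b) a) => //.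
    by rewrite memvZ.
  by rewrite scale1r.
have : x' \in (<[w + phi u]> + <[phi v]>)%VS.
  by rewrite (R_line Reu Rv Rx)// ?euN// /x addrA memv_add ?memv_line.
case/memv_addP=> _ /vlineP[c1 ->] [_ /vlineP[c2 ->] x'E].
have : x' \in (<[w + phi v]> + <[phi u]>)%VS.
  by rewrite (R_line Rev Ru Rx)// ?euN// /x [u + v]addrC addrA memv_add
    ?memv_line.
case/memv_addP=> _ /vlineP[c3 ->] [_ /vlineP[c4 ->] x'E'].
have [|c13 c14 c23] := @indep u v (c1 - c3) (c1 - c4) (c2 - c3) uE vE u0 vNu.
  rewrite -(subrr x') {1}x'E x'E'.
  by apply/rowP=> i; rewrite !mxE; ring.
have {}x'E : x' = c1 *: (w + (phi u + phi v)).
  rewrite x'E (_ : c2 = c1) ?scalerDr ?addrA//.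
  by move/eqP: c23; rewrite subr_eq0 => /eqP->; move/eqP: c13;
    rewrite subr_eq0 => /eqP->.
have c1_neq0 : c1 != 0.
  by have [_] := R_U Rx; rewrite x'E scaler_eq0 negb_or => /andP[].
have : z' \in (<[phi u]> + <[phi v]>)%VS.
  by rewrite (R_line Ru Rv Rz)// memv_add ?memv_line.
case/memv_addP=> _ /vlineP[k1 ->] [_ /vlineP[k2 ->] z'E].
have : z' \in (<[w]> + <[x']>)%VS.
  rewrite (R_line Re0 Rx Rz).
    have -> : u + v = - e0 + x by rewrite /x addKr.
    by rewrite memv_add ?memvN ?memv_line.
  apply/negP=> /vlineP[k kE]; case/negP: (notin_e0 uvE uv0).
  apply/vlineP; exists (k - 1); rewrite scalerBl scale1r -kE /x.
  by rewrite addrAC subrr add0r.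
case/memv_addP=> _ /vlineP[k3 ->] [_ /vlineP[k4 ->] z'E'].
have [|_ k12 k22] := @indep u v (k3 + k4 * c1) (k4 * c1 - k1) (k4 * c1 - k2) uE
  vE u0 vNu.
  rewrite -(subrr z') {1}z'E' x'E z'E.
  by apply/rowP=> i; rewrite !mxE; ring.
have {}z'E : z' = k1 *: (phi u + phi v).
  rewrite z'E scalerDr (_ : k2 = k1)//.
  by move/eqP: k22; rewrite subr_eq0 => /eqP<-; move/eqP: k12;
    rewrite subr_eq0 => /eqP.
have k1_neq0 : k1 != 0.
  by have [_] := R_U Rz; rewrite z'E scaler_eq0 negb_or => /andP[].
have [_ _ fx] := Rx; have [_ _ fz] := Rz.
by rewrite /P fz z'E vline_scale// fx x'E vline_scale// !eqxx.
Qed.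

Let E_indep v : exists2 u, u \in E & u \notin <[v]>%VS.
Proof.
apply/subvPn/negP=> /dimvS; rewrite dim_vline => dimE.
have := dimv_sum_cap U (<[e0]>^C)%VS; rewrite -/E dimv_compl dim_vline e0_neq0.
have := dimvS (subvf U); have := dimvS (subvf (U + <[e0]>^C)).
by move: dimU dimE; case: (v != 0); lia.
Qed.

Let phiD_notin u v : u \in E -> v \in E -> v \notin <[u]>%VS ->
  phi (u + v) = phi u + phi v.
Proof.
have [->|u0] := eqVneq u 0; first by rewrite phi0 !add0r.
by move=> uE vE; apply: phiD_indep.
Qed.

Let phiZ_ex v k : v \in E -> v != 0 -> exists c, phi (k *: v) = c *: phi v.
Proof.
move=> vE v0; have [->|k0] := eqVneq k 0.
  by exists 0; rewrite !scale0r phi0.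
have kv0 : k *: v != 0 by rewrite scaler_eq0 negb_or k0.
have /andP[/eqP fkv _] := phiP (memvZ k vE) kv0.
have /andP[/eqP fv _] := phiP vE v0.
by apply/vlineP; rewrite -fv -(vline_scale v k0) fkv memv_line.
Qed.

Let v0 := vpick E.

Let v0E : v0 \in E. Proof. exact: memv_pick. Qed.

Let v0_neq0 : v0 != 0.
Proof.
rewrite vpick0; apply/eqP=> E0; have [u] := E_indep 0.
by rewrite E0 !memv0 => /eqP->; rewrite eqxx.
Qed.

Let sigma k := odflt 0 [pick c | phi (k *: v0) == c *: phi v0].

Let sigmaP k : phi (k *: v0) = sigma k *: phi v0.
Proof.
rewrite /sigma; case: pickP => [c /eqP //|none].
by have [c cE] := phiZ_ex k v0E v0_neq0; have := none c; rewrite cE eqxx.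
Qed.

Let notin_neq0 u v : v \notin <[u]>%VS -> v != 0.
Proof. by apply: contraNneq => ->; rewrite mem0v. Qed.

Let phiZ_transfer u v k : u \in E -> v \in E -> u != 0 -> v \notin <[u]>%VS ->
  phi (k *: u) = sigma k *: phi u -> phi (k *: v) = sigma k *: phi v.
Proof.
move=> uE vE u0 vNu phiu; have [->|k0] := eqVneq k 0.
  rewrite scale0r phi0; have := sigmaP 0; rewrite scale0r phi0 => /esym/eqP.
  by rewrite scaler_eq0 (negPf (phi_neq0 v0E v0_neq0)) orbF => /eqP->;
    rewrite scale0r.
have uv0 : u + v != 0.
  apply: contraNneq vNu => /eqP; rewrite addrC addr_eq0 => /eqP->.
  by rewrite memvN memv_line.
have kvNku : k *: v \notin <[k *: u]>%VS.
  rewrite (vline_scale u k0); apply: contra vNu => /(memvZ k^-1).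
  by rewrite scalerA mulVf ?scale1r.
have [c cE] := phiZ_ex k (memvD uE vE) uv0.
have [d dE] := phiZ_ex k vE (notin_neq0 vNu).
move: cE; rewrite scalerDr (phiD_notin (memvZ k uE) (memvZ k vE) kvNku).
rewrite (phiD_notin uE vE vNu) phiu dE => cE.
have [|_ kc dc] := @indep u v 0 (sigma k - c) (d - c) uE vE u0 vNu.
  rewrite -(subrr (c *: (phi u + phi v))) -{1}cE.
  by apply/rowP=> i; rewrite !mxE; ring.
move/eqP: kc; rewrite subr_eq0 => /eqP->.
by move/eqP: dc; rewrite subr_eq0 => /eqP->.
Qed.

Let phiZ k v : v \in E -> phi (k *: v) = sigma k *: phi v.
Proof.
move=> vE; have [->|v_neq0] := eqVneq v 0; first
  by rewrite scaler0 phi0 scaler0.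
have [vv0|vNv0] := boolP (v \in <[v0]>%VS); last first.
  exact: (phiZ_transfer v0E vE v0_neq0 vNv0 (sigmaP k)).
have [u uE uNv0] := E_indep v0.
apply: (phiZ_transfer uE vE (notin_neq0 uNv0)); last first.
  exact: (phiZ_transfer v0E uE v0_neq0 uNv0 (sigmaP k)).
apply: contra uNv0 => /(vline_sym v_neq0) /vlineP[c ->].
by rewrite memvZ.
Qed.

Let phiD u v : u \in E -> v \in E -> phi (u + v) = phi u + phi v.
Proof.
move=> uE vE; have [vu|] := boolP (v \in <[u]>%VS); last exact: phiD_notin.
have [x xE xNu] := E_indep u; apply: (@addIr _ (phi x)).
have notin y : y \in <[u]>%VS -> x \notin <[y]>%VS.
  by move=> yu; apply: contra xNu => /vlineP[c ->]; rewrite memvZ.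
have uvNx : x \notin <[u + v]>%VS by apply/notin/memvD => //; apply: memv_line.
rewrite -(phiD_notin (memvD uE vE) xE uvNx) -[in LHS]addrA -[in RHS]addrA.
rewrite -(phiD_notin vE xE (notin _ vu)) (phiD_notin uE (memvD vE xE))//.
by apply: contra xNu => vxu; rewrite -(addKr v x) addrC memvB.
Qed.

Let sigma_inj_scale (a b : F) : sigma a = b <-> phi (a *: v0) = b *: phi v0.
Proof.
rewrite sigmaP; split=> [->//|/eqP]; rewrite -subr_eq0 -scalerBl scaler_eq0.
by rewrite (negPf (phi_neq0 v0E v0_neq0)) orbF subr_eq0 => /eqP.
Qed.

Let sigma_zmod : zmod_morphism sigma.
Proof.
move=> a b; apply/sigma_inj_scale; rewrite scalerBl;
  apply: (@addIr _ (phi (b *: v0))).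
by rewrite -phiD ?memvB ?memvZ// subrK sigmaP phiZ// scalerBl subrK.
Qed.

Let sigma_monoid : monoid_morphism sigma.
Proof.
split; first by apply/sigma_inj_scale; rewrite !scale1r.
by move=> a b; apply/sigma_inj_scale; rewrite -scalerA !phiZ ?memvZ// scalerA.
Qed.

Theorem fundamental_theorem : exists (s : {rmorphism F -> F}) g,
  [/\ is_semilinear s g, forall v, g v \in U &
      forall v, v \in U -> v != 0 -> g v != 0 /\ f <[v]>%VS = <[g v]>%VS].
Proof.
have [s sE] : exists s : {rmorphism F -> F}, s =1 sigma.
  pose s : {rmorphism F -> F} :=
    HB.pack sigma (GRing.isZmodMorphism.Build _ _ sigma sigma_zmod)
                  (GRing.isMonoidMorphism.Build _ _ sigma sigma_monoid).
  by exists s.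
pose c v := coord [tuple e0] ord0 (projv <[e0]> v).
have cD (a : F) u v : c (a *: u + v) = a * c u + c v by rewrite /c !linearP.
have cE v : projv <[e0]> v = c v *: e0.
  have := memv_proj <[e0]>%VS v; rewrite -span_seq1 => /coord_span {1}->.
  by rewrite big_ord1 span_seq1.
pose d v := v - c v *: e0.
have dE v : v \in U -> d v \in E.
  move=> vU; rewrite /d memv_cap memvB ?memvZ//= -cE.
  exact: memv_projC.
have dD (a : F) u v : d (a *: u + v) = a *: d u + d v.
  by rewrite /d cD; apply/rowP=> i; rewrite !mxE; ring.
pose g0 v := s (c v) *: w + phi (d v).
have [wU w0] := R_U Re0.
have phiU v : v \in E -> phi v \in U.
  move=> vE; have [->|v_neq0] := eqVneq v 0; first by rewrite phi0 mem0v.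
  by have [/R_U[]] := PR vE v_neq0 (phiP vE v_neq0).
have projU v : projv U v \in U by apply: memv_proj.
exists s, (fun v => g0 (projv U v)); split=> [a u v|v|v vU v_neq0].
- rewrite linearP /= /g0 cD dD phiD ?memvZ ?dE ?projU// phiZ ?dE ?projU//.
  by rewrite rmorphD rmorphM -sE scalerDl scalerDr scalerA addrACA.
- by rewrite memvD ?memvZ ?phiU ?dE.
rewrite projv_id// /g0; set k := c v.
have vE : v = k *: e0 + d v by rewrite /d addrC subrK.
have uE := dE v vU; move: (d v) vE uE => u vE uE.
suff fv : f <[v]>%VS = <[s k *: w + phi u]>%VS.
  split=> //; have : R v (s k *: w + phi u) by split.
  by case/R_U.
rewrite vE; have [k0|k_neq0] := eqVneq k 0.
  rewrite k0 rmorph0 !scale0r !add0r.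
  have u0 : u != 0 by move: v_neq0; rewrite vE k0 scale0r add0r.
  by have /andP[/eqP] := phiP uE u0.
have -> : k *: e0 + u = k *: (e0 + k^-1 *: u).
  by rewrite scalerDr scalerA divff// scale1r.
rewrite vline_scale//; have [->|u0] := eqVneq u 0.
  rewrite scaler0 phi0 !addr0 vline_scale ?fmorph_eq0//.
  by case: Re0.
have kuE : k^-1 *: u \in E by apply: memvZ.
have ku0 : k^-1 *: u != 0 by rewrite scaler_eq0 negb_or invr_eq0 k_neq0.
have /andP[_ /eqP->] := phiP kuE ku0.
rewrite phiZ// -sE fmorphV -(@vline_scale _ _ (s k)) ?fmorph_eq0//.
by rewrite scalerDr scalerA divff ?fmorph_eq0// scale1r.
Qed.

End FundamentalTheorem.

(** * Collineations preserving a quadric *)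

Section Semisimilarity.
Context {F : finFieldType} {n : nat} (Q : 'rV[F]_n -> F).
Context (quadQ : quadratic_form Q) (F_even : ~~ odd #|F|).
Implicit Types (U : {vspace 'rV[F]_n}) (u v w x y p r : 'rV[F]_n).
Implicit Types (s : {rmorphism F -> F}).
Local Notation B := (polar_form Q).

(* If p is singular and B v p != 0, then Q vanishes at exactly one point of
   v + <p>, so the singular vectors determine Q v / B v p. *)
Lemma semisimilarity U s g p r : is_semilinear s g -> hyperbolic_pair Q U p r ->
    {in U, forall v, (Q (g v) == 0) = (Q v == 0)} ->
  exists2 c, c != 0 & {in U, forall v, Q (g v) = c * s (Q v)}.
Proof.
move=> lin_g [pU rU Qp Qr Bpr] gQ.
have [s' [sK s'K]] := fmorph_finK s.
have Qgp : Q (g p) = 0 by apply/eqP; rewrite gQ// Qp.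
have Qgr : Q (g r) = 0 by apply/eqP; rewrite gQ// Qr.
have QD v t q : Q q = 0 -> Q (v + t *: q) = Q v + t * B v q.
  by move=> Qq; rewrite quadD// quadZ// Qq mulr0 addr0 polarZr.
have gD v t q : g (v + t *: q) = g v + s t *: g q.
  by rewrite (semilinearD lin_g) (semilinearZ lin_g).
have orth q v : q \in U -> v \in U -> Q q = 0 -> B v q = 0 -> B (g v) (g q) = 0.
  move=> qU vU Qq Bvq; have Qgq : Q (g q) = 0 by apply/eqP; rewrite gQ// Qq.
  apply/eqP; apply: contraT => B0; have vtU t : v + t *: q \in U
    by rewrite memvD ?memvZ.
  pose t := s' (- Q (g v) / B (g v) (g q)).
  have : Q (g (v + t *: q)) == 0.
    by rewrite gD QD// s'K divfK// addrN.
  rewrite gQ// QD// Bvq mulr0 addr0 => Qv.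
  have : Q (g (v + 1 *: q)) == 0 by rewrite gQ// QD// Bvq mulr0 addr0.
  have : Q (g v) == 0 by rewrite gQ.
  by rewrite gD QD// rmorph1 mul1r => /eqP->; rewrite add0r (negPf B0).
pose c := B (g r) (g p).
have BgE v : v \in U -> B (g v) (g p) = s (B v p) * c.
  move=> vU; have : B (g (v - B v p *: r)) (g p) = 0.
    apply: orth => //; first by rewrite memvB ?memvZ.
    by rewrite polarDl// polarNl// polarZl// (polarC _ r) Bpr mulr1 subrr.
  rewrite -scaleNr gD polarDl// polarZl// rmorphN mulNr => /eqP.
  by rewrite subr_eq0 => /eqP.
have BgE' v : v \in U -> B (g v) (g r) = s (B v r) * c.
  move=> vU; have : B (g (v - B v r *: p)) (g r) = 0.
    apply: orth => //; first by rewrite memvB ?memvZ.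
    by rewrite polarDl// polarNl// polarZl// Bpr mulr1 subrr.
  rewrite -scaleNr gD polarDl// polarZl// rmorphN mulNr => /eqP.
  by rewrite subr_eq0 => /eqP->; rewrite (polarC _ (g p)).
have main v : v \in U -> B v p != 0 -> Q (g v) = c * s (Q v).
  move=> vU Bvp; pose t := - Q v / B v p.
  have : Q (g (v + t *: p)) == 0.
    by rewrite gQ ?memvD ?memvZ// QD// divfK// addrN.
  rewrite gD QD// BgE// mulrA -rmorphM divfK// rmorphN mulNr subr_eq0 => /eqP->.
  by rewrite mulrC.
have all v : v \in U -> Q (g v) = c * s (Q v).
  move=> vU; have [Bvp|] := eqVneq (B v p) 0; last exact: main.
  have := main (v + 1 *: r); rewrite memvD ?memvZ// => /(_ isT).
  rewrite polarDl// Bvp add0r polarZl// mul1r (polarC _ r) Bpr oner_neq0 => /(_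
    isT).
  rewrite gD !QD// BgE'// rmorph1 !mul1r (rmorphD s (Q v)) (mulrDr c) [c * s (B
    v r)]mulrC.
  by move/addIr.
exists c => //; apply/eqP=> c0; have := gQ (p + 1 *: r).
rewrite memvD ?memvZ// all ?memvD ?memvZ// c0 mul0r eqxx QD// Qp Bpr add0r
  mulr1.
by rewrite oner_eq0 => /(_ isT).
Qed.

Lemma collineation_semi_isometry U f p r : collineation U f -> (2 < \dim U)%N ->
    hyperbolic_pair Q U p r -> image (quadric Q U) f = quadric Q U ->
  exists s g, [/\ is_semilinear s g, forall v, g v \in U,
    {in U, forall v, Q (g v) = s (Q v)} &
    forall v, v \in U -> v != 0 -> g v != 0 /\ f <[v]>%VS = <[g v]>%VS].
Proof.
move=> coll_f dimU hyp fQ.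
have [s [g [lin_g gU gf]]] := fundamental_theorem coll_f dimU.
have gQ : {in U, forall v, (Q (g v) == 0) = (Q v == 0)}.
  move=> v vU; have [->|v0] := eqVneq v 0.
    by rewrite (semilinear0 lin_g).
  have [gv0 fv] := gf v vU v0; apply/eqP/eqP => Qv.
    move: (proj2 (quadricE quadQ (gU v) gv0) Qv); rewrite -fv -fQ => -[q qQ fq].
    have [[_ f_inj _] _] := coll_f.
    apply/(quadricE quadQ vU v0); rewrite (f_inj _ _ _ _ (esym fq))//;
      apply/mem_set.
      exact: points_vline.
    by case: qQ.
  apply/(quadricE quadQ (gU v) gv0); rewrite -fv -fQ; exists <[v]>%VS => //.
  exact/quadricE.
have [c c0 cE] := semisimilarity lin_g hyp gQ.
have [d d2] := square_root_char2 F_even c^-1.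
have d0 : d != 0.
  by apply: contraNneq c0 => d0; rewrite -invr_eq0 -d2 d0 expr0n.
exists s, (fun v => d *: g v); split.
- by move=> a x y; rewrite lin_g scalerDr !scalerA mulrC.
- by move=> v; rewrite memvZ.
- by move=> v vU; rewrite quadZ// d2 cE// mulKf.
- move=> v vU v0; have [gv0 ->] := gf v vU v0.
  by rewrite scaler_eq0 negb_or d0 vline_scale.
Qed.

End Semisimilarity.

(** * Elliptic solids and the hyperovals H_O *)

Section MinusType.
Context {F : finFieldType} {n : nat} (Q : 'rV[F]_n -> F).
Context (quadQ : quadratic_form Q) (F_even : ~~ odd #|F|).
Context (U : {vspace 'rV[F]_n}) (dimU : \dim U = 4) (minusU : minus_type_on Q
  U).
Implicit Types (W : {vspace 'rV[F]_n}) (u v w x y p r : 'rV[F]_n).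
Local Notation B := (polar_form Q).

Lemma minus_type_singular_dim W : (W <= U)%VS -> totally_singular Q W -> (\dim
  W <= 1)%N.
Proof.
have [_ [m + [_ +]]] := minusU; rewrite dimU.
by case: m => [|[|m]]// _; apply.
Qed.

Lemma totally_singular_add v w : Q v = 0 -> Q w = 0 -> B v w = 0 ->
  totally_singular Q (<[v]> + <[w]>)%VS.
Proof.
move=> Qv Qw Bvw _ /memv_addP[_ /vlineP[a ->] [_ /vlineP[b ->] ->]].
by rewrite quadD !(quadZ quadQ) Qv Qw (polarZl quadQ) (polarZr quadQ) Bvw
  !mulr0 !addr0.
Qed.

Lemma minus_type_orthogonal_singular v w : v \in U -> w \in U -> v != 0 ->
  Q v = 0 -> Q w = 0 -> B v w = 0 -> w \in <[v]>%VS.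
Proof.
move=> vU wU v0 Qv Qw Bvw; apply: contraT => wNv.
have := minus_type_singular_dim _ (totally_singular_add Qv Qw Bvw).
by rewrite dim_add_vline// subv_add -!memvE vU wU => /(_ isT).
Qed.

Lemma minus_type_hyperbolic_pair : exists p r, hyperbolic_pair Q U p r.
Proof.
have [nd [m dimE [[W [WU dimW] singW] _]]] := minusU.
have m1 : m = 1%N by move: dimE; rewrite dimU; case: (m) => [|[|]].
rewrite {}m1 in dimW.
pose p := vpick W; have pW : p \in W by apply: memv_pick.
have p0 : p != 0 by rewrite vpick0 -dimv_eq0 dimW.
have pU : p \in U by apply: subvP pW.
have Qp := singW p pW.
have [[w wU Bpw]|none] := pselect (exists2 w, w \in U & B p w != 0).
  by exists p; apply: (hyperbolic_pair_exists quadQ pU wU).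
case/negP: p0; apply/eqP/nd => // w wU; apply: contrapT => /eqP Bpw.
by apply: none; exists w.
Qed.

Lemma minus_type_nondeg : polar_nondegenerate Q U.
Proof.
have [p [r [pU rU Qp Qr Bpr]]] := minus_type_hyperbolic_pair.
have Bpp : B p p = 0 := polarvv quadQ F_even p.
have Brr : B r r = 0 := polarvv quadQ F_even r.
have Brp : B r p = 1 by rewrite polarC.
have p0 : p != 0.
  by apply: contraTneq (oner_neq0 F) => p0; rewrite -Bpr p0 (polar0l quadQ)
    eqxx.
have rNp : r \notin <[p]>%VS.
  apply: contraTN (oner_neq0 F) => /vlineP[k rE]; rewrite negbK.
  by rewrite -Bpr rE (polarZr quadQ) Bpp mulr0.
pose m := (<[p]> + <[r]>)%VS.
have pm : p \in m := memv_addl_line p r.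
have rm : r \in m := memv_addr_line p r.
have mU : (m <= U)%VS by rewrite subv_add -!memvE pU rU.
have ndm : polar_nondegenerate Q m.
  move=> _ /memv_addP[_ /vlineP[a ->] [_ /vlineP[b ->] ->]] Bv.
  have := Bv p pm; rewrite (polarDl quadQ) !(polarZl quadQ) Bpp Brp mulr0 add0r
    mulr1 => ->.
  have := Bv r rm; rewrite (polarDl quadQ) !(polarZl quadQ) Brr Bpr mulr0 addr0
    mulr1 => ->.
  by rewrite !scale0r addr0.
pose A := (U :&: perp Q m)%VS.
have cap0 : (m :&: A = 0)%VS.
  by apply/eqP; rewrite -subv0 -(cap_perp_nondeg quadQ ndm) capvS// capvSr.
have dimA : \dim A = 2.
  apply/eqP; rewrite eqn_leq; apply/andP; split.
    have : (\dim (m + A) <= \dim U)%N by apply: dimvS;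
      rewrite subv_add mU capvSl.
    by rewrite (dimv_disjoint_sum cap0) dim_add_vline// dimU.
  have := dim_cap_perp quadQ m U; rewrite dimU dim_add_vline//.
  by rewrite -/A; lia.
have ellA : elliptic_line Q A.
  split=> // z; rewrite memv_cap => /andP[zU zm] Qz.
  have := @minus_type_orthogonal_singular p z pU zU p0 Qp Qz.
  have Bpz : B p z = 0 by rewrite polarC; apply: (perpP quadQ _ _ zm).
  move/(_ Bpz) => /vlineP[k zE]; apply/eqP.
  rewrite zE scaler_eq0 (negPf p0) orbF; apply/eqP.
  have := perpP quadQ _ _ zm r rm; rewrite zE (polarZl quadQ) Bpr mulr1. by [].
move=> v vU Bv; have [x xm [y ym vE]] := perp_split quadQ v ndm.
have x0 : x = 0.
  apply: ndm => // w wm; have := Bv w (subvP mU _ wm).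
  by rewrite vE (polarDl quadQ) (perpP quadQ _ _ ym w wm) addr0.
move: vE; rewrite x0 add0r => vE; rewrite -vE in ym.
apply: (elliptic_nondeg quadQ F_even ellA); first by rewrite memv_cap vU.
by move=> w; rewrite memv_cap => /andP[wU _]; apply: Bv.
Qed.

End MinusType.

Section KleinQuadric.
Context {F : finFieldType} (F_even : ~~ odd #|F|).
Context (Q : 'rV[F]_6 -> F) (quadQ : quadratic_form Q) (Q_plus : plus_type_on Q
  fullv).
Context (Pi : {vspace 'rV[F]_6}) (dim_Pi : \dim Pi = 4) (Pi_minus :
  minus_type_on Q Pi).
Implicit Types (U W L T X : {vspace 'rV[F]_6}) (u v w x y z l : 'rV[F]_6).
Implicit Types (O : set {vspace 'rV[F]_6}).
Local Notation B := (polar_form Q).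

Let nd_Pi : polar_nondegenerate Q Pi := minus_type_nondeg quadQ F_even dim_Pi
  Pi_minus.

(* A singular vector in the perp of Pi would lie in a totally singular plane W,
   and W and Pi both lie in its perp, hence would share a totally singular
     line. *)
Lemma perp_elliptic_line : elliptic_line Q (perp Q Pi).
Proof.
split=> [|p pPi Qp]; first by rewrite dim_perp// dim_Pi.
apply/eqP; apply: contraT => p0; exfalso.
have [nd [m dimE [[W [_ dimW] singW] _]]] := Q_plus.
have {}dimW : \dim W = 3.
  by rewrite dimW; move: dimE; rewrite dimvf /dim /=; lia.
have pp : p \in perp Q <[p]>%VS by rewrite perp_line// polarvv.
pose W0 := (W :&: perp Q <[p]>)%VS; pose W1 := (W0 + <[p]>)%VS.
have singW1 : totally_singular Q W1.
  move=> _ /memv_addP[w + [_ /vlineP[k ->] ->]].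
  rewrite memv_cap perp_line// => /andP[wW /eqP Bwp].
  by rewrite quadD (quadZ quadQ) Qp singW// (polarZr quadQ) Bwp !mulr0 !addr0.
have dimp : \dim <[p]>%VS = 1 by rewrite dim_vline p0.
have dimW1 : (3 <= \dim W1)%N.
  have [pW|pNW] := boolP (p \in W).
    suff /dimvS : (W <= W1)%VS by rewrite dimW.
    apply: subv_trans (addvSl _ _).
    apply/subvP=> w wW; rewrite memv_cap wW perp_line//.
    have := singW _ (memvD wW pW).
    by rewrite quadD !singW// !add0r => /eqP.
  rewrite dimv_disjoint_sum.
    by have := dim_cap_perp quadQ <[p]>%VS W; rewrite dimp dimW -/W0; lia.
  apply/eqP; rewrite -subv0; apply/subvP=> x; rewrite !memv_cap memv0.
  case/andP=> /andP[xW _] xp; apply: contraT => x0; case/negP: pNW.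
  by have /vlineP[k ->] := vline_sym x0 xp; rewrite memvZ.
have sub : (Pi + W1 <= perp Q <[p]>)%VS.
  have PiS : (Pi <= perp Q <[p]>)%VS.
    by apply/subvP=> x xPi; rewrite perp_line// polarC (perpP quadQ _ _ pPi).
  by rewrite subv_add PiS subv_add capvSr -memvE.
have dim5 : (\dim (perp Q <[p]>)%VS <= 5)%N.
  rewrite -ltnS ltn_neqAle; apply/andP; split; last first.
    by apply: leq_trans (dimvS (subvf _)) _; rewrite dimvf.
  apply/eqP=> dim6; case/negP: p0; apply/eqP/nd; rewrite ?memvf// => w _.
  have : w \in perp Q <[p]>%VS.
    suff -> : perp Q <[p]>%VS = fullv by rewrite memvf.
    by apply/eqP; rewrite eqEdim subvf dim6 dimvf.
  by rewrite perp_line// polarC => /eqP.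
have := minus_type_singular_dim dim_Pi Pi_minus (capvSl Pi W1).
have singC : totally_singular Q (Pi :&: W1)%VS.
  by move=> x; rewrite memv_cap => /andP[_ /singW1].
move/(_ singC).
have := dimv_sum_cap Pi W1; have := dimvS sub; lia.
Qed.

Let nd_perp : polar_nondegenerate Q (perp Q Pi).
Proof. exact (elliptic_nondeg quadQ F_even perp_elliptic_line). Qed.

Lemma perp_perp_Pi : perp Q (perp Q Pi) = Pi.
Proof. exact (perp_perp quadQ nd_Pi nd_perp). Qed.

Lemma W_lines_isotropic L x y : W_lines Q Pi L -> x \in L -> y \in L -> B x y =
  0.
Proof.
move=> [[LPi dimL] [p [[[pL dimp] [_ singp]] puniq]]] xL yL.
have [z z0 pE] := dim1_vline dimp; subst p.
have zL : z \in L by rewrite memvE.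
have Qz : Q z = 0 by apply: singp; apply: memv_line.
have Bz u : u \in L -> B z u = 0.
  move=> uL; have [/vlineP[k ->]|uNz] := boolP (u \in <[z]>%VS).
    by rewrite polarZr// polarvv// mulr0.
  apply/eqP; apply: contraT => Bzu.
  pose t := - Q u / B z u; have vL : u + t *: z \in L by rewrite memvD ?memvZ.
  have Qv : Q (u + t *: z) = 0.
    rewrite quadD (quadZ quadQ) Qz mulr0 addr0 (polarZr quadQ) (polarC _ u).
    by rewrite divfK// addrN.
  have v0 : u + t *: z != 0.
    by apply: contraNneq uNz => /eqP; rewrite addr_eq0 => /eqP->;
      rewrite memvN memvZ// memv_line.
  case/negP: uNz; rewrite -(addrK (t *: z) u) memvB ?memvZ ?memv_line//.
  rewrite memvE (puniq <[u + t *: z]>%VS)//; split; first exact: points_vline.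
  split; last exact: totally_singular_line.
  by apply: points_vline; rewrite // (subvP LPi).
have [u uL uNz] : exists2 u, u \in L & u \notin <[z]>%VS.
  by apply/subvPn/negP=> /dimvS; rewrite dimL dim_vline z0.
have LE := line2_span dimL zL uL z0 uNz.
have [a [b ->]] := LE x xL; have [c [d ->]] := LE y yL.
by rewrite !(polarE quadQ) (polarC _ u z) !(polarvv quadQ F_even) Bz// !(mulr0,
  addr0).
Qed.

Lemma isotropic_W_lines x y : x \in Pi -> y \in Pi -> x != 0 -> y \notin
  <[x]>%VS ->
  B x y = 0 -> W_lines Q Pi (<[x]> + <[y]>)%VS.
Proof.
move=> xPi yPi x0 yNx Bxy; set L := (_ + _)%VS.
have LPi : (L <= Pi)%VS by rewrite subv_add -!memvE xPi.
have xL : x \in L := memv_addl_line x y.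
have yL : y \in L := memv_addr_line x y.
have isoL u v : u \in L -> v \in L -> B u v = 0.
  move=> /memv_addP[_ /vlineP[a ->] [_ /vlineP[b ->] ->]].
  move=> /memv_addP[_ /vlineP[c ->] [_ /vlineP[d ->] ->]].
  by rewrite !(polarE quadQ) (polarC _ y x) !(polarvv quadQ F_even) Bxy
    !(mulr0, addr0).
split; first by split; rewrite ?dim_add_vline.
have [z [zL z0 Qz]] : exists z, [/\ z \in L, z != 0 & Q z = 0].
  have [Qx|Qx] := eqVneq (Q x) 0; first by exists x.
  have [c c2] := square_root_char2 F_even (Q y / Q x).
  exists (y + c *: x); split; first by rewrite memvD ?memvZ.
    by apply: contraNneq yNx => /eqP; rewrite addr_eq0 => /eqP->;
      rewrite memvN memvZ// memv_line.
  rewrite quadD (quadZ quadQ) (polarZr quadQ) (polarC _ y) Bxy c2 mulr0 addr0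
    divfK//.
  exact: addrr_pchar2 (pchar2_of_even F_even) _.
exists <[z]>%VS; split.
  split; first exact: points_vline.
  by split; [apply: points_vline => //; apply: subvP zL|exact:
    totally_singular_line].
move=> p [[pL dimp] [_ singp]].
have [u u0 pE] := dim1_vline dimp; subst p.
have uL : u \in L by rewrite memvE.
apply/esym/vline_eq => //.
apply: (minus_type_orthogonal_singular quadQ dim_Pi Pi_minus) => //.
- exact: subvP zL.
- exact: subvP uL.
- by apply: singp; apply: memv_line.
- exact: isoL.
Qed.

Lemma tangent_planeE x : x \in Pi -> x != 0 ->
  tangent_plane Q Pi <[x]>%VS = (Pi :&: perp Q <[x]>)%VS.
Proof.
move=> xPi x0; set T := (_ :&: _)%VS.
have xT : x \in T by rewrite memv_cap xPi perp_line// (polarvv quadQ F_even)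
  eqxx.
have TPi : (T <= Pi)%VS := capvSl _ _.
have dimT : \dim T = 3.
  apply/eqP; rewrite eqn_leq; apply/andP; split.
    rewrite -ltnS -[X in (_ < X)%N]dim_Pi ltn_neqAle dimvS// andbT.
    apply/negP=> dimE; case/negP: x0; apply/eqP/nd_Pi => // w wPi.
    have : w \in T by rewrite (_ : T = Pi)//; apply/eqP;
      rewrite eqEdim TPi (eqP dimE) /=.
    by rewrite memv_cap perp_line// polarC => /andP[_ /eqP].
  have := dim_cap_perp quadQ <[x]>%VS Pi.
  by rewrite dim_Pi dim_vline x0 -/T addn1.
have TL y : y \in T -> y \notin <[x]>%VS -> W_lines Q Pi (<[x]> + <[y]>)%VS.
  rewrite memv_cap perp_line// polarC => /andP[yPi /eqP Bxy] yNx.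
  exact: isotropic_W_lines.
apply: xget_unique; first split=> //.
  move=> L LW; rewrite -memvE => xL; apply/subvP=> y yL.
  have [[LPi _] _] := LW; rewrite memv_cap (subvP LPi)//= perp_line//.
  by rewrite (W_lines_isotropic LW).
move=> p [[pPi dimp] pL]; apply/esym/eqP; rewrite eqEdim dimT dimp leqnn andbT.
have [y0 y0T y0N] : exists2 y, y \in T & y \notin <[x]>%VS.
  by apply/subvPn/negP=> /dimvS; rewrite dimT dim_vline x0.
have sub y : y \in T -> y \notin <[x]>%VS -> (<[x]> + <[y]> <= p)%VS.
  by move=> yT yN; apply: pL; [apply: TL|apply: addvSl].
apply/subvP=> y yT; have [yx|yN] := boolP (y \in <[x]>%VS).
  apply: (subvP (sub _ y0T y0N)); exact: subvP (addvSl _ _) _ yx.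
by apply: (subvP (sub _ yT yN)); apply: memv_addr_line.
Qed.

Lemma perp_tangent_plane x y l : x \in Pi -> x != 0 -> y \in Pi -> l \in perp Q
  Pi ->
  (y + l \in perp Q (tangent_plane Q Pi <[x]>%VS)) = (y \in <[x]>%VS).
Proof.
move=> xPi x0 yPi lP; rewrite tangent_planeE//.
have Bl w : w \in Pi -> B l w = 0 := perpP quadQ _ _ lP w.
apply/(perpP quadQ)/vlineP=> [Byl|[k ->] w]; last first.
  rewrite memv_cap perp_line// => /andP[wPi /eqP Bwx].
  by rewrite (polarDl quadQ) (polarZl quadQ) Bl// polarC Bwx mulr0 addr0.
have [z zPi Bxz] : exists2 z, z \in Pi & B x z = 1.
  have [[z zPi Bxz]|none] := pselect (exists2 z, z \in Pi & B x z != 0).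
    by exists ((B x z)^-1 *: z); rewrite ?memvZ// polarZr// mulVf.
  case/negP: x0; apply/eqP/nd_Pi => // z zPi; apply: contrapT => /eqP Bxz.
  by apply: none; exists z.
exists (B y z); apply/eqP; rewrite -subr_eq0; apply/eqP/nd_Pi.
  by rewrite memvB ?memvZ.
move=> w wPi; have : B (y + l) (w - B x w *: z) = 0.
  apply: Byl; rewrite memv_cap memvB ?memvZ//= perp_line// polarC.
  by rewrite (polarDr quadQ) (polarNr quadQ) (polarZr quadQ) Bxz mulr1 subrr.
rewrite (polarDl quadQ) Bl ?memvB ?memvZ// addr0 => <-.
by rewrite !(polarE quadQ); ring.
Qed.

Definition vectors_of O : pred 'rV[F]_6 := fun v => (v != 0) && `[< O <[v]>%VS
  >].

Lemma vectors_ofP O v : v != 0 -> reflect (O <[v]>%VS) (vectors_of O v).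
Proof. by move=> v0; rewrite /vectors_of v0; apply: asboolP. Qed.

Lemma ovoid_partial_ovoid O : W_ovoid Q Pi O -> partial_ovoid Q Pi (vectors_of
  O).
Proof.
move=> [_ ovO] x y xPi yPi /andP[x0 /asboolP Ox] /andP[y0 /asboolP Oy] Bxy.
apply: contraT => yNx.
have [p [_ puniq]] := ovO _ (isotropic_W_lines xPi yPi x0 yNx Bxy).
have px := puniq <[x]>%VS; have py := puniq <[y]>%VS.
case/negP: yNx; rewrite memvE -px ?py//; split=> //.
  by apply: points_vline => //; apply: memv_addr_line.
by apply: points_vline => //; apply: memv_addl_line.
Qed.

Lemma hyperoval_represents O : W_ovoid Q Pi O ->
  represents Q (perp Q Pi) (vectors_of O) (vectors_of (hyperoval_of Q Pi O)).
Proof.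
move=> [OPi _] y l; rewrite perp_perp_Pi => yPi lP yl0.
have Byl : B y l = 0 by rewrite polarC (perpP quadQ _ _ lP).
have QE : (Q (y + l) == 0) = (Q y == Q l).
  by rewrite quadD Byl addr0 addr_eq0 (oppr_pchar2 (pchar2_of_even F_even)).
have conicE x : x \in Pi -> x != 0 ->
    conic Q Pi <[x]>%VS <[y + l]>%VS <-> y \in <[x]>%VS /\ Q y = Q l.
  move=> xPi x0; rewrite /conic; split.
    case=> -[+ _] /(quadricE quadQ (memvf _) yl0)/eqP.
    by rewrite -memvE perp_tangent_plane// QE => ? /eqP.
  move=> [yx Qyl]; split; last by apply/(quadricE quadQ (memvf _) yl0)/eqP;
    rewrite QE Qyl.
  by apply: points_vline; rewrite ?perp_tangent_plane.
have [dimP anP] := perp_elliptic_line.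
apply/(vectors_ofP _ yl0)/andP.
  case=> [[X [OX XNQ]]|[yQ yNO]].
    have [XPi dimX] := OPi _ OX; have [x x0 XE] := dim1_vline dimX.
    subst X; rewrite -memvE in XPi; rename XPi into xPi; rename OX into Ox.
    rename XNQ into xNQ.
    move/(conicE _ xPi x0) => [yx Qyl]; rewrite Qyl eqxx; split=> //.
    have y0 : y != 0.
      apply: contra_neq yl0 => y0; rewrite y0 add0r; apply: anP => //.
      by rewrite -Qyl y0 (quad0 quadQ).
    rewrite /vectors_of (vline_eq y0 yx) y0 (asboolT Ox) eq_sym eqb_id /=.
    apply/eqP=> l0; apply: xNQ; apply/quadricE => //.
    have /vlineP[k ->] := vline_sym y0 yx.
    by rewrite (quadZ quadQ) Qyl l0 (quad0 quadQ) mulr0.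
  have [[]] := yQ; rewrite -memvE => ylPi _ sing.
  have l0 : l = 0.
    apply: nd_perp => // w wP.
    have lPi : l \in Pi by rewrite -(addKr y l) addrC memvB.
    by rewrite polarC (perpP quadQ _ _ wP).
  move: yl0 yNO (sing _ (memv_line _)); rewrite l0 addr0 (quad0 quadQ) eqxx =>
    y0 yNO ->.
  rewrite eqxx; split=> //; rewrite eqbF_neg.
  by apply/negP=> /(vectors_ofP _ y0).
move=> [/eqP Qyl /eqP Oy]; have [l0|l0] := eqVneq l 0.
  right; rewrite l0 addr0 in yl0 *; rewrite l0 eqxx in Oy; split.
    by apply/quadricE => //; rewrite Qyl l0 (quad0 quadQ).
  by move/(vectors_ofP _ yl0); rewrite Oy.
have Ql : Q l != 0 by apply: contra_neq l0; apply: anP.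
have y0 : y != 0 by apply: contra_neq Ql => y0; rewrite -Qyl y0 (quad0 quadQ).
left; exists <[y]>%VS; last by apply/conicE => //; rewrite memv_line.
split; first by apply/(vectors_ofP _ y0); rewrite Oy.
by move/(quadricE quadQ yPi y0)/eqP; rewrite Qyl (negPf Ql).
Qed.

End KleinQuadric.

(** * Extending and restricting collineations *)

Section InducedCollineation.
Context {F : finFieldType} {n : nat} (U : {vspace 'rV[F]_n}).
Context (s : {rmorphism F -> F}) (g : 'rV[F]_n -> 'rV[F]_n).
Context (lin_g : is_semilinear s g) (gU : {in U, forall v, g v \in U}).
Context (g_inj : {in U, forall v, g v = 0 -> v = 0}).

Lemma semilinear_inj_in : {in U &, injective g}.
Proof.
move=> x y xU yU gxy; apply/eqP; rewrite -subr_eq0; apply/eqP/g_inj.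
  exact: memvB.
by rewrite (semilinearD lin_g) (semilinearN lin_g) gxy subrr.
Qed.

Lemma semilinear_onto : {in U, forall w, exists2 v, v \in U & g v = w}.
Proof.
move=> w wU; have : w \in [set g v | v in [set v | v \in U]].
  suff -> : [set g v | v in [set v | v \in U]] = [set v | v \in U]
    by rewrite inE.
  apply/eqP; rewrite eqEcard card_in_imset ?leqnn ?andbT.
    by apply/fintype.subsetP=> _ /imsetP[v + ->]; rewrite !inE => /gU.
  by move=> x y; rewrite !inE; apply: semilinear_inj_in.
by case/imsetP=> v; rewrite inE => vU ->; exists v.
Qed.

Lemma semilinear_collineation : collineation U (semilinear_img g).
Proof.
have imgU W : (W <= U)%VS -> (semilinear_img g W <= U)%VS.
  move=> WU; apply/subvP=> _ /(semilinear_imgP lin_g)[u uW ->].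
  by apply: gU; apply: subvP uW.
have mem_img W v : (W <= U)%VS -> v \in U ->
    (g v \in semilinear_img g W) = (v \in W).
  move=> WU vU; apply/(semilinear_imgP lin_g)/idP=> [[u uW]|vW];
    last by exists v.
  by move/semilinear_inj_in => ->//; apply: subvP uW.
have dim_img W : (W <= U)%VS -> \dim (semilinear_img g W) = \dim W.
  move=> WU; apply/eqP; rewrite -(eqn_exp2l _ _ (finNzRing_gt1 F))
    -!card_vspace.
  rewrite -[#|W|](card_in_imset (f := g) (D := mem W)).
    by apply/eqP/eq_card=> v; apply/(semilinear_imgP lin_g)/imsetP.
  by move=> x y xW yW; apply: semilinear_inj_in;
    apply: subvP xW || apply: subvP yW.
have img_inj W W' : (W <= U)%VS -> (W' <= U)%VS ->
    semilinear_img g W = semilinear_img g W' -> W = W'.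
  move=> WU W'U E; apply/vspaceP=> v; apply/idP/idP=> vW.
    by rewrite -mem_img// -?E ?mem_img//; apply: subvP vW.
  by rewrite -mem_img// ?E ?mem_img//; apply: subvP vW.
have onto p : points U p -> exists2 q, points U q & semilinear_img g q = p.
  move=> [pU /dim1_vline[w w0 pE]]; move: pU; rewrite {p}pE -memvE => wU.
  have [v vU gv] := semilinear_onto wU; exists <[v]>%VS.
    apply: points_vline => //; apply: contraNneq w0 => v0.
    by rewrite -gv v0 (semilinear0 lin_g).
  by rewrite (semilinear_img_line lin_g) gv.
split; first split.
- by move=> p [pU dimp]; split; [apply: imgU|rewrite dim_img].
- by move=> p q /set_mem[pU _] /set_mem[qU _]; apply: img_inj.
- by move=> p /onto[q qU qE]; exists q.
move=> L [LU dimL]; exists (semilinear_img g L).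
  by split; [apply: imgU|rewrite dim_img].
apply/seteqP; split=> [_ [p [pL dimp] <-]|p [pL dimp]].
  split; last by rewrite dim_img// (subv_trans pL).
  apply/subvP=> _ /(semilinear_imgP lin_g)[u up ->].
  by apply/(semilinear_imgP lin_g); exists u => //; apply: subvP up.
have [q [qU dimq] qE] : exists2 q, points U q & semilinear_img g q = p.
  by apply: onto; split=> //; apply: subv_trans pL (imgU _ LU).
exists q => //; split=> //; apply/subvP=> u uq.
by rewrite -mem_img// ?(subvP qU)// (subvP pL)// -qE;
  apply/(semilinear_imgP lin_g); exists u.
Qed.

Lemma semilinear_image (A A' : set {vspace 'rV[F]_n}) :
    (A `<=` points U)%classic -> (A' `<=` points U)%classic ->
    (forall v, v \in U -> v != 0 -> A <[v]>%VS <-> A' <[g v]>%VS) ->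
  image A (semilinear_img g) = A'.
Proof.
move=> AU A'U AA'; apply/seteqP; split=> [_ [p Ap <-]|p A'p].
  have [pU /dim1_vline[v v0 pE]] := AU _ Ap; move: pU Ap.
  by rewrite pE -memvE => vU Av; rewrite (semilinear_img_line lin_g); apply/AA'.
have [pU /dim1_vline[w w0 pE]] := A'U _ A'p; move: pU A'p.
rewrite {p}pE -memvE => wU A'w; have [v vU gv] := semilinear_onto wU.
exists <[v]>%VS; last by rewrite (semilinear_img_line lin_g) gv.
apply/AA' => //; last by rewrite gv.
by apply: contraNneq w0 => v0; rewrite -gv v0 (semilinear0 lin_g).
Qed.

End InducedCollineation.

Lemma collineation_image_iff (F : finFieldType) n (U : {vspace 'rV[F]_n}) f
    (A A' : set {vspace 'rV[F]_n}) v :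
    collineation U f -> (A `<=` points U)%classic -> image A f = A' ->
    v \in U -> v != 0 -> A <[v]>%VS <-> A' (f <[v]>%VS).
Proof.
move=> [[_ f_inj _] _] AU <- vU v0; split=> [Av|[p Ap fp]];
  first by exists <[v]>%VS.
rewrite -(f_inj _ _ _ _ fp)//; apply/mem_set; last exact: points_vline.
exact: AU.
Qed.

Section KleinQuadric.
Context {F : finFieldType} (F_even : ~~ odd #|F|).
Context (Q : 'rV[F]_6 -> F) (quadQ : quadratic_form Q) (Q_plus : plus_type_on Q
  fullv).
Context (Pi : {vspace 'rV[F]_6}) (dim_Pi : \dim Pi = 4) (Pi_minus :
  minus_type_on Q Pi).
Context (O1 O2 : set {vspace 'rV[F]_6}).
Context (O1_ovoid : W_ovoid Q Pi O1) (O2_ovoid : W_ovoid Q Pi O2).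
Implicit Types (u v w x y l : 'rV[F]_6).
Local Notation B := (polar_form Q).
Local Notation L := (perp Q Pi).
Local Notation H1 := (vectors_of (hyperoval_of Q Pi O1)).
Local Notation H2 := (vectors_of (hyperoval_of Q Pi O2)).

Let ellL : elliptic_line Q L.
Proof. exact (perp_elliptic_line F_even quadQ Q_plus dim_Pi Pi_minus). Qed.

Let perpL : perp Q L = Pi.
Proof. exact (perp_perp_Pi F_even quadQ Q_plus dim_Pi Pi_minus). Qed.

Let rep1 : represents Q L (vectors_of O1) H1.
Proof. exact (hyperoval_represents F_even quadQ Q_plus dim_Pi Pi_minus
  O1_ovoid). Qed.

Let rep2 : represents Q L (vectors_of O2) H2.
Proof. exact (hyperoval_represents F_even quadQ Q_plus dim_Pi Pi_minus
  O2_ovoid). Qed.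

Let ov1 : partial_ovoid Q (perp Q L) (vectors_of O1).
Proof. by rewrite perpL; exact (ovoid_partial_ovoid F_even quadQ dim_Pi
  Pi_minus O1_ovoid). Qed.

Let ov2 : partial_ovoid Q (perp Q L) (vectors_of O2).
Proof. by rewrite perpL; exact (ovoid_partial_ovoid F_even quadQ dim_Pi
  Pi_minus O2_ovoid). Qed.

Let hyperoval_points O : (hyperoval_of Q Pi O `<=` points fullv)%classic.
Proof.
by move=> p [[x _ [[_ dimp] _]]|[[[_ dimp] _] _]]; split; rewrite ?subvf.
Qed.

Let quadric_points (U : {vspace 'rV[F]_6}) : (quadric Q U `<=` points
  U)%classic.
Proof. by move=> p []. Qed.

Lemma vectors_of_eq (A A' : set {vspace 'rV[F]_6}) v w : v != 0 -> w != 0 ->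
  (vectors_of A v = vectors_of A' w) <-> (A <[v]>%VS <-> A' <[w]>%VS).
Proof.
rewrite /vectors_of => -> -> /=; split=> [E|]; last exact: asbool_equiv_eq.
by split=> ?; apply/asboolP; [rewrite -E|rewrite E]; apply/asboolP.
Qed.

Lemma ovoid_collineation_of_hyperoval f :
    collineation fullv f -> image (Qplus Q) f = Qplus Q ->
    image (hyperoval_of Q Pi O1) f = hyperoval_of Q Pi O2 ->
  exists g, [/\ collineation Pi g, image (Qminus Q Pi) g = Qminus Q Pi
               & image O1 g = O2].
Proof.
move=> coll_f fQ fH.
have [p [r [pPi rPi Qp Qr Bpr]]] := minus_type_hyperbolic_pair quadQ dim_Pi
  Pi_minus.
have hypV : hyperbolic_pair Q fullv p r by split; rewrite ?memvf.
have dimV : (2 < \dim {: 'rV[F]_6})%N by rewrite dimvf.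
have [s [k0 [lin0 _ Qk0 fk0]]] := collineation_semi_isometry quadQ F_even
  coll_f dimV hypV fQ.
have iso0 : semi_isometry Q s k0 by split=> // v; apply: Qk0; apply: memvf.
have k0_neq0 v : v != 0 -> k0 v != 0 by move=> v0;
  have [] := fk0 v (memvf v) v0.
have k0_inj : injective k0.
  move=> x y kxy; apply/eqP; rewrite -subr_eq0; apply: contraT => /k0_neq0.
  by rewrite (semilinearD lin0) (semilinearN lin0) kxy subrr eqxx.
have [k0' k0K k0'K] := injF_bij k0_inj.
have H12 v : H1 v = H2 (k0 v).
  have [->|v0] := eqVneq v 0; first by rewrite (semilinear0 lin0) /vectors_of
    eqxx.
  have [kv0 fv] := fk0 v (memvf v) v0; apply/vectors_of_eq => //.
  by rewrite -fv; apply: (collineation_image_iff coll_f (@hyperoval_points O1)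
    fH) => //; exact: memvf.
have H12' : H1 \o k0' = H2 by apply/funext=> v /=; rewrite H12 k0'K.
have rep' := represents_img quadQ iso0 k0K k0'K rep1; rewrite H12' in rep'.
have ov' := partial_ovoid_img quadQ iso0 k0K k0'K ov1.
have ell' : elliptic_line Q (semilinear_img k0 L).
  have [dimL anL] := ellL; split; last exact (anisotropic_img iso0 anL).
  by rewrite (dim_semilinear_img lin0).
have [h [[linh Qh] hH hL]] := represents_conjugate quadQ F_even ellL ell' rep2
  rep' ov2 ov'.
pose k := h \o k0.
have link : is_semilinear s k by move=> a x y; rewrite /k /= lin0 linh.
have Qk v : Q (k v) = s (Q v) by rewrite /k /= Qh /= Qk0 ?memvf.
have isok : semi_isometry Q s k by split.
have k_inj : injective k by apply: inj_comp k0_inj; apply: perm_inj.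
have k_neq0 v : v != 0 -> k v != 0.
  by move=> v0; rewrite -(semilinear0 link) (inj_eq k_inj).
have kH v : H2 (k v) = H1 v by rewrite /k /= hH H12.
have kL v : (k v \in L) = (v \in L).
  by rewrite /k /= hL (mem_semilinear_img lin0 _ _ k0K k0'K) k0K.
have [k' kK k'K] := injF_bij k_inj.
have kPi : {in Pi, forall v, k v \in Pi}.
  move=> v; rewrite -{1}perpL => vL; rewrite -perpL;
    apply/(perpP quadQ) => l lL.
  rewrite -[l]k'K (semi_isometry_polar _ _ isok) (perpP quadQ _ _ vL)
    ?rmorph0//.
  by rewrite -kL k'K.
have [dimL anL] := ellL.
have [u [w [uL _ Qu _ _]]] := normalized_basis_exists quadQ F_even dimL anL.
have kO x : x \in Pi -> x != 0 -> vectors_of O1 x = vectors_of O2 (k x).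
  move=> xPi x0; have kxPi := kPi x xPi; rewrite -perpL in xPi kxPi.
  have [Qx|Qx] := eqVneq (Q x) 0.
    have := kH x; rewrite (represents_on quadQ rep1)// (represents_on quadQ
      rep2) ?k_neq0//.
    by rewrite Qk Qx rmorph0 eqxx /= => /negb_inj.
  have [d d2] := square_root_char2 F_even (Q x).
  have d0 : d != 0 by apply: contraNneq Qx => d0; rewrite -d2 d0 expr0n.
  have duL : d *: u \in L by apply: memvZ.
  have Qdu : Q (d *: u) = Q x by rewrite (quadZ quadQ) Qu mulr1.
  have du0 : d *: u != 0 by apply: contraNneq Qx => du0;
    rewrite -Qdu du0 (quad0 quadQ).
  have := kH (x + d *: u); rewrite (semilinearD link).
  rewrite (represents_off quadQ F_even ellL rep1)// Qdu eqxx.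
  rewrite (represents_off quadQ F_even ellL rep2) ?kL ?k_neq0//.
  by rewrite !Qk Qdu eqxx.
have k_inj0 : {in Pi, forall v, k v = 0 -> v = 0}.
  by move=> v _ kv; apply: k_inj; rewrite kv (semilinear0 link).
exists (semilinear_img k); split.
- exact: semilinear_collineation link kPi k_inj0.
- apply: (semilinear_image link kPi k_inj0) => [||v vPi v0];
  try exact: quadric_points.
  have vE := quadricE quadQ vPi v0.
  have kvE := quadricE quadQ (kPi v vPi) (k_neq0 v v0).
  split=> [/vE Qv|/kvE]; first by apply/kvE; rewrite Qk Qv rmorph0.
  by rewrite Qk => /eqP; rewrite fmorph_eq0 => /eqP/vE.
- have [O1Pi _] := O1_ovoid; have [O2Pi _] := O2_ovoid.
  apply: (semilinear_image link kPi k_inj0) => // v vPi v0.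
  by apply/vectors_of_eq; rewrite ?k_neq0//; apply: kO.
Qed.

Lemma hyperoval_collineation_of_ovoid g :
    collineation Pi g -> image (Qminus Q Pi) g = Qminus Q Pi -> image O1 g = O2
      ->
  exists f, [/\ collineation fullv f, image (Qplus Q) f = Qplus Q
               & image (hyperoval_of Q Pi O1) f = hyperoval_of Q Pi O2].
Proof.
move=> coll_g gQ gO.
have [p [r hyp]] := minus_type_hyperbolic_pair quadQ dim_Pi Pi_minus.
have dimPi_gt2 : (2 < \dim Pi)%N by rewrite dim_Pi.
have [s [k [link kPi Qk gk]]] := collineation_semi_isometry quadQ F_even coll_g
  dimPi_gt2 hyp gQ.
have [s' [sK s'K]] := fmorph_finK s.
have [dimL anL] := ellL.
have [u [w basL]] := normalized_basis_exists quadQ F_even dimL anL.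
have no_root := normalized_basis_no_root quadQ F_even anL basL.
have [t tE] : exists t : F, t ^+ 2 + t + Q w = s (Q w).
  apply: artin_schreier_sum => // x; rewrite -[x]s'K -rmorphXn -!rmorphD
    fmorph_eq0.
  exact: no_root.
have [] := normalized_basis_shift quadQ F_even t basL; rewrite tE.
move: (w + _) => w' [_ w'L _ Buw' _] Qw'.
have [uL wL Qu Buw LE] := basL.
pose pi v := v - (B v w *: u + B v u *: w).
pose psi v := s (B v w) *: u + s (B v u) *: w'.
pose f v := k (pi v) + psi v.
have linf : is_semilinear s f.
  move=> a x y; rewrite /f /psi.
  have -> : pi (a *: x + y) = a *: pi x + pi y.
    by rewrite /pi !(polarE quadQ); apply/rowP=> i; rewrite !mxE; ring.
  have sD b c : s (a * b + c) = s a * s b + s c by rewrite rmorphD rmorphM.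
  rewrite link !(polarE quadQ) (sD (B x w)) (sD (B x u)).
  move: (k _) (k _) (s _) (s _) (s _) (s _) (s _) => k1 k2 s1 s2 s3 s4 s5.
  by apply/rowP=> i; rewrite !mxE; ring.
have perpLE x l : x \in Pi -> l \in L -> B x l = 0.
  by move=> xPi lL; rewrite polarC (perpP quadQ _ _ lL).
have fE x l : x \in Pi -> l \in L -> f (x + l) = k x + psi l.
  move=> xPi lL; rewrite /f /pi /psi !(polarDl quadQ) !(perpLE x)// !add0r.
  by rewrite -(LE l lL) addrK.
have psiL l : l \in L -> psi l \in L by rewrite memvD ?memvZ.
have Qpsi l : l \in L -> Q (psi l) = s (Q l).
  move=> lL; rewrite [in RHS](LE l lL) /psi !quadD !(quadZ quadQ) !(polarE
    quadQ).
  move: (B l w) (B l u) => a b; rewrite Qu Qw' Buw Buw'.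
  by rewrite !rmorphD !rmorphM rmorph1; ring.
have Qf v : Q (f v) = s (Q v).
  have [l lL [x xL ->]] := perp_split quadQ v (elliptic_nondeg quadQ F_even
    ellL).
  rewrite perpL in xL; rewrite addrC fE// (quadD Q (k x)) (quadD Q x) Qk//
    Qpsi//.
  rewrite !perpLE ?psiL ?kPi// !addr0.
  by rewrite rmorphD.
have k_neq0 x : x \in Pi -> x != 0 -> k x != 0 by move=> xPi /(gk x xPi)[].
have psi0 l : l \in L -> (psi l == 0) = (l == 0).
  move=> lL; apply/eqP/eqP=> [psil|->]; last first.
    by rewrite /psi !(polar0l quadQ) !rmorph0 !scale0r addr0.
  apply: anL => //; apply/eqP; rewrite -(fmorph_eq0 s) -Qpsi// psil.
  by rewrite (quad0 quadQ).
have k0E x : x \in Pi -> (k x == 0) = (x == 0).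
  move=> xPi; apply/idP/idP=> [|/eqP->]; last by rewrite (semilinear0 link).
  by apply: contraTT; apply: k_neq0.
have f0 v : f v = 0 -> v = 0.
  have [l lL [x xL ->]] := perp_split quadQ v (elliptic_nondeg quadQ F_even
    ellL).
  have xPi : x \in Pi by rewrite -perpL.
  have kxL : k x \in perp Q L by rewrite perpL kPi.
  move/eqP; rewrite addrC fE// (perp_add_eq0 quadQ F_even ellL) ?psiL//.
  by rewrite psi0// k0E// => /andP[/eqP-> /eqP->]; rewrite addr0.
have fV : {in fullv, forall v, f v \in fullv} by move=> v _; apply: memvf.
have f0V : {in fullv, forall v, f v = 0 -> v = 0} by move=> v _; apply: f0.
have f_neq0 v : v != 0 -> f v != 0 by apply: contra_neq => /f0.
have kO x : x \in Pi -> vectors_of O1 x = vectors_of O2 (k x).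
  move=> xPi; have [->|x0] := eqVneq x 0.
    by rewrite (semilinear0 link) /vectors_of eqxx.
  have [kx0 gx] := gk x xPi x0; apply/vectors_of_eq => //; rewrite -gx.
  by apply: (collineation_image_iff coll_g _ gO) => //; case: O1_ovoid.
have fH v : v != 0 -> H1 v = H2 (f v).
  have [l lL [x xL ->]] := perp_split quadQ v (elliptic_nondeg quadQ F_even
    ellL).
  rewrite addrC => xl0; have xPi : x \in Pi by rewrite -perpL.
  have fxl0 := f_neq0 _ xl0; rewrite fE// in fxl0 *.
  rewrite rep1// rep2 ?psiL ?perpL//.
  by rewrite Qk// Qpsi// (inj_eq (fmorph_inj s)) psi0// kO.
exists (semilinear_img f); split.
- exact: semilinear_collineation linf fV f0V.
- apply: (semilinear_image linf fV f0V) => [||v vV v0];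
  try exact: quadric_points.
  have vE := quadricE quadQ vV v0.
  have fvE := quadricE quadQ (fV v vV) (f_neq0 v v0).
  split=> [/vE Qv|/fvE]; first by apply/fvE; rewrite Qf Qv rmorph0.
  by rewrite Qf => /eqP; rewrite fmorph_eq0 => /eqP/vE.
- apply: (semilinear_image linf fV f0V) => [||v vV v0];
  try exact: hyperoval_points.
  by apply/vectors_of_eq; rewrite ?f_neq0//; apply: fH.
Qed.

End KleinQuadric.

Local Open Scope classical_set_scope.

Theorem theorem4p31 (F : finFieldType) (q_even : ~~ odd #|F|)
    (Q : 'rV[F]_6 -> F) (Q_quadratic : quadratic_form Q)
    (Q_plus : plus_type_on Q fullv)
    (Pi : {vspace 'rV[F]_6}) (dim_Pi : \dim Pi = 4%N)
    (Q_minus : minus_type_on Q Pi)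
    (O1 O2 : set {vspace 'rV[F]_6})
    (O1_ovoid : W_ovoid Q Pi O1) (O1_neq : O1 <> Qminus Q Pi)
    (O2_ovoid : W_ovoid Q Pi O2) (O2_neq : O2 <> Qminus Q Pi) :
  (exists f, [/\ collineation fullv f, f @` Qplus Q = Qplus Q
               & f @` hyperoval_of Q Pi O1 = hyperoval_of Q Pi O2])
  <->
  (exists g, [/\ collineation Pi g, g @` Qminus Q Pi = Qminus Q Pi
               & g @` O1 = O2]).
Proof.
split=> [[f [coll_f fQ fH]]|[g [coll_g gQ gO]]].
  exact (ovoid_collineation_of_hyperoval q_even Q_quadratic Q_plus dim_Pi
           Q_minus O1_ovoid O2_ovoid coll_f fQ fH).
exact (hyperoval_collineation_of_ovoid q_even Q_quadratic Q_plus dim_Pi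
         Q_minus O1_ovoid O2_ovoid coll_g gQ gO).
Qed.
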